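(* Every block sequence $(x_i)$ of the unit vector basis $(e_i)$ of $S$ has a subsequence $(y_i)$ whose closed linear span $Y$ in $S$ is isomorphic to its square $Y\oplus Y$.
   Context: Let $c_{00}$ be the space of finitely supported real sequences with standard basis $(e_i)_{i\in\mathbb{N}}$. For nonempty $E,F\subset\mathbb{N}$ write $E<F$ if $\max E<\min F$; for nonzero $x,y\in c_{00}$ write $x<y$ if $\operatorname{supp}(x)<\operatorname{supp}(y)$. A block sequence of $(e_i)$ is a sequence $(x_i)$ of nonzero vectors in $c_{00}$ with $x_1<x_2<\cdots$. For $x=\sum_i x_ie_i\in c_{00}$ and $E\subset\mathbb{N}$ put $E(x)=\sum_{i\in E}x_ie_i$. Let $f(n)=\log_2(n+1)$. The space $S$ (Schlumprecht's space) is the completion of $c_{00}$ under the unique norm $\|\cdot\|$ on $c_{00}$ satisfying the implicit equation $$\|x\|=\max\Big\{\|x\|_{\ell_\infty},\ \sup_{n\ge2,\ E_1<E_2<\dots<E_n}\frac1{f(n)}\sum_{i=1}^n\|E_i(x)\|\Big\},$$ where the supremum is over integers $n\ge2$ and subsets $E_1<\dots<E_n$ of $\mathbb{N}$. *)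

(* Defs.v *)
From mathcomp Require Import all_boot all_order all_algebra.
From mathcomp Require Import all_classical all_reals all_analysis.

Set Implicit Arguments.
Unset Strict Implicit.
Unset Printing Implicit Defensive.

Import Order.TTheory GRing.Theory Num.Theory.
Import numFieldNormedType.Exports.

Local Open Scope classical_set_scope.
Local Open Scope ring_scope.

Definition supp (R : realType) (x : nat -> R) : set nat := [set i | x i != 0].

Definition c00 (R : realType) : set (nat -> R) :=
  [set x | finite_set (supp x)].

(* [max E < min F] for nonempty sets: when both are nonempty, the condition
   below forces [E] to be bounded, so that the maximum exists. *)
Definition set_lt (E F : set nat) : Prop :=
  [/\ E !=set0, F !=set0 & forall i j, E i -> F j -> (i < j)%N].

Definition coord_restr (R : realType) (E : set nat) (x : nat -> R) : nat -> R :=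
  patch (fun=> 0) E x.

Definition schlumprecht_f (R : realType) (n : nat) : R :=
  ln (n.+1)%:R / ln 2.

Definition is_norm_c00 (R : realType) (N : (nat -> R) -> R) : Prop :=
  [/\ forall x, c00 x -> N x = 0 -> x = 0,
      forall (a : R) x, c00 x -> N (a *: x) = `|a| * N x
    & forall x y, c00 x -> c00 y -> N (x + y) <= N x + N y].

(* The suprema are taken in the extended reals, so the equation also asserts
   that they are finite; only the first [n] terms of [E] matter. *)
Definition schlumprecht_eq (R : realType) (N : (nat -> R) -> R) : Prop :=
  forall x, c00 x ->
    (N x)%:E =
    Order.max
      (ereal_sup [set `|x i|%:E | i in [set: nat]])
      (ereal_sup [set s | exists (n : nat) (E : nat -> set nat),
         [/\ (2 <= n)%N,
             forall i, (i.+1 < n)%N -> set_lt (E i) (E i.+1)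
           & s = ((schlumprecht_f R n)^-1
                    * \sum_(i < n) N (coord_restr (E i) x))%:E]]).

Definition is_schlumprecht_norm (R : realType) (N : (nat -> R) -> R) : Prop :=
  is_norm_c00 N /\ schlumprecht_eq N.

(* [S], together with the embedding [iota] of c00, is a completion of c00
   for the norm [N]; the values of [N] and [iota] outside c00 are
   irrelevant. *)
Definition is_completion_c00 (R : realType) (N : (nat -> R) -> R)
    (S : completeNormedModType R) (iota : (nat -> R) -> S) : Prop :=
  [/\ forall (a : R) x y, c00 x -> c00 y ->
        iota (a *: x + y) = a *: iota x + iota y,
      forall x, c00 x -> `|iota x| = N x
    & closure (iota @` @c00 R) = [set: S]].

Definition is_block_sequence (R : realType) (x : nat -> nat -> R) : Prop :=
  [/\ forall n, c00 (x n),
      forall n, x n <> 0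
    & forall n, set_lt (supp (x n)) (supp (x n.+1))].

Definition closed_span (R : realType) (V : normedModType R) (y : nat -> V) :
    set V :=
  closure [set v | exists (n : nat) (a : nat -> R),
                     v = \sum_(i < n) a i *: y i].

(* Isomorphism of the normed spaces carried by the subspaces [A] and [B]:
   mutually inverse bounded linear maps.  Both maps are total on the ambient
   spaces, but only their restrictions to [A] and [B] are constrained. *)
Definition isomorphic_subspaces (R : realType) (V W : normedModType R)
    (A : set V) (B : set W) : Prop :=
  exists (T : V -> W) (U : W -> V),
    [/\ set_fun A B T /\ set_fun B A U,
        {in A, cancel T U} /\ {in B, cancel U T},
        forall (a : R) u v, A u -> A v -> T (a *: u + v) = a *: T u + T v,
        {within A, continuous T}
      & {within B, continuous U}].

(* Main.v *)
Require Import Defs.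
From mathcomp Require Import all_boot all_order all_algebra.
From mathcomp Require Import all_classical all_reals all_analysis.
From mathcomp Require Import zify ring lra.

(** Let [Gam m y] be the supremum of the sums of the norms of [m] successive
pieces of [y]: this is all that a node of arity [m] of a norming tree sees of
[y].  Pass to a normalized subsequence [(y_i)] and numbers [N_0 < N_1 < ...]
such that the profiles [m |-> Gam m y_i] have stabilized for [m <= N_i], while
[y_i] is negligible at nodes of arity above [N_(i+1)].  Compare the norms of
[sum a_i y_(p i)] and [sum a_i y_(q i)], where [i <= p i, q i <= 2i + 1].  At a
node of arity [n] with [N_k < n <= N_(k+1)] the vectors with indices [i > k] of
both sums look alike, and the part with indices [i <= k] costs at most a
constant times its own norm.  These costs arise at every node of the tree, and
the point is that they do not add up.  The cost of a child whose arity is much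
larger than the arity [n] of its parent can be charged to the parent, using
[3n] pieces there instead of [n], for a factor [f (3n) / f n = 1 + O(1 / f n)];
a child of comparable arity [m] is harmless because [f n * f m] is much larger
than [f (n * m)]; a run of children of small arities gains a factor [f 2 >= 3/2]
at each step.  Hence [(y_i)], [(y_(2i))] and [(y_(2i+1))] are equivalent, and by
unconditionality the span [Y] of [(y_i)] is the direct sum of the spans of
[(y_(2i))] and [(y_(2i+1))], both isomorphic to [Y]. *)

Set Implicit Arguments.
Unset Strict Implicit.
Unset Printing Implicit Defensive.

Import Order.TTheory GRing.Theory Num.Theory.
Import numFieldNormedType.Exports.

Local Open Scope classical_set_scope.
Local Open Scope ring_scope.

(** * The Schlumprecht norm on finitely supported sequences *)

(** Losses at the nodes would multiply along a tree whose depth is unbounded. So some constant [C],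
    at first depending on the length of the sum, is taken as known and improved to [B + C / 2] with
    [B] independent of the length; iteration brings it down to [2 * B]. For this [C] may be used
    only where it has a small weight. Arities are therefore sorted on the scale [2 ^ (4 ^ l)], and
    the estimate descends from a large [l], where it is trivial for a finite sum, to a fixed [l0].
    The step from [l.+1] to [l] loses [C] times a multiple of [l / 2 ^ l], which is summable. The
    constant cost of the indices [i <= k] is delicate when [k < p i]: the vector on one side then
    still has the limit profile [g], while its partner may come early. If [g = o(f)], such vectors
    are cheap. Otherwise [g] is comparable to [f] at arbitrarily large arities; by
    [p i <= 2 * i + 1] the partners have index at least [k / 2], so that they have the profile [g]
    at an arity above [k], and this makes them behave like the basis of l1. *)

Section SchlumprechtFunction.
Variable R : realType.
Local Notation f := (schlumprecht_f R).

Lemma ln2_gt0 : 0 < ln 2 :> R.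
Proof. by apply: ln_gt0; rewrite ltr1n. Qed.

Lemma schlumprecht_f_mono m n : (m <= n)%N -> f m <= f n.
Proof.
move=> mn; rewrite /schlumprecht_f ler_pM2r ?invr_gt0 ?ln2_gt0//.
by rewrite ler_ln ?posrE ?ltr0n// ler_nat ltnS.
Qed.

Lemma schlumprecht_f1 : f 1 = 1.
Proof. by rewrite /schlumprecht_f divff// gt_eqF// ln2_gt0. Qed.

Lemma schlumprecht_f_ge1 n : (0 < n)%N -> 1 <= f n.
Proof. by move=> n0; rewrite -schlumprecht_f1 schlumprecht_f_mono. Qed.

Lemma schlumprecht_f_gt0 n : (0 < n)%N -> 0 < f n.
Proof. by move=> n0; apply: lt_le_trans (schlumprecht_f_ge1 n0). Qed.

Lemma schlumprecht_f_ge e n : (2 ^ e <= n)%N -> e%:R <= f n.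
Proof.
move=> en; rewrite /schlumprecht_f ler_pdivlMr ?ln2_gt0//.
rewrite mulr_natl -lnXn ?ltr0n// -natrX ler_ln ?posrE ?ltr0n ?expn_gt0//.
by rewrite ler_nat (leq_trans en).
Qed.

Lemma schlumprecht_f_le e n : (n < 2 ^ e)%N -> f n <= e%:R.
Proof.
move=> en; rewrite /schlumprecht_f ler_pdivrMr ?ln2_gt0//.
rewrite mulr_natl -lnXn ?ltr0n// -natrX ler_ln ?posrE ?ltr0n ?expn_gt0//.
by rewrite ler_nat.
Qed.

Lemma schlumprecht_f_exp2_le e n : (n <= 2 ^ e)%N -> f n <= e.+1%:R.
Proof.
move=> en; apply: schlumprecht_f_le; apply: (leq_ltn_trans en).
by rewrite ltn_exp2l.
Qed.

(** Since [2 ^ 3 <= 3 ^ 2]. Nodes have arity at least 2, so this is the origin of the factors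
    [2 / 3] gained per level of a tree. *)
Lemma schlumprecht_f_ge32 n : (2 <= n)%N -> 3 / 2 <= f n.
Proof.
move=> n2; apply: le_trans (schlumprecht_f_mono n2).
rewrite /schlumprecht_f ler_pdivlMr ?ln2_gt0//.
have : (ln 2 : R) *+ 3 <= ln 3 *+ 2.
  rewrite -!lnXn ?ltr0n// -!natrX ler_ln ?posrE ?ltr0n// ler_nat//.
rewrite -[ln 2 *+ 3]mulr_natr -[ln 3 *+ 2]mulr_natr.
move: (ln (2 : R)) (ln (3 : R)) => a b ?; lra.
Qed.

End SchlumprechtFunction.

Section FinitelySupported.
Variable R : realType.
Implicit Types (x y : nat -> R) (P Q : pred nat).

(** A boolean form of [coord_restr], so that restrictions compose and are compared by
    computation. *)
Definition keep P x : nat -> R := fun i => if P i then x i else 0.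

Lemma c00P x : c00 x <-> exists M, forall i, (M <= i)%N -> x i = 0.
Proof.
split=> [|[M xM]].
  rewrite /c00 /= => /finite_seqP[s sE].
  exists (\max_(i <- s) i.+1) => i; apply: contraTeq => xi; rewrite -ltnNge.
  have : i \in s by have : [set` s] i by rewrite -sE.
  by move=> is_; exact: (@leq_bigmax_seq _ s xpredT succn i is_).
apply: (sub_finite_set _ (finite_II M)) => i; rewrite /supp /=.
by apply: contraNT; rewrite -leqNgt => /xM ->.
Qed.

Lemma c000 : @c00 R 0. Proof. by apply/c00P; exists 0. Qed.

Lemma c00D x y : c00 x -> c00 y -> c00 (x + y).
Proof.
move=> /c00P[M xM] /c00P[M' yM]; apply/c00P; exists (maxn M M') => i.
by rewrite geq_max => /andP[/xM xi /yM yi]; rewrite fctE xi yi addr0.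
Qed.

Lemma c00Z a x : c00 x -> c00 (a *: x).
Proof.
move=> /c00P[M xM]; apply/c00P; exists M => i /xM xi.
by rewrite -[LHS]/(a * x i) xi mulr0.
Qed.

Lemma c00_sum (I : Type) (r : seq I) (Q : pred I) (F : I -> nat -> R) :
  (forall i, Q i -> c00 (F i)) -> c00 (\sum_(i <- r | Q i) F i).
Proof. by move=> FQ; elim/big_ind : _ => //; [exact: c000|exact: c00D]. Qed.

Lemma c00_keep P x : c00 x -> c00 (keep P x).
Proof.
by move=> /c00P[M xM]; apply/c00P; exists M => i /xM xi; rewrite /keep xi if_same.
Qed.

Lemma coord_restrE (E : set nat) x : coord_restr E x = keep (fun i => i \in E) x.
Proof. by []. Qed.

Lemma keepD P x y : keep P (x + y) = keep P x + keep P y.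
Proof.
by apply/funext => i; rewrite /keep !fctE; case: ifP => //; rewrite addr0.
Qed.

Lemma keepZ P a x : keep P (a *: x) = a *: keep P x.
Proof.
apply/funext => i; rewrite -[RHS]/(a * keep P x i) /keep; case: ifP => //.
by rewrite mulr0.
Qed.

Lemma keep0 P : keep P 0 = 0 :> (nat -> R).
Proof. by apply/funext => i; rewrite /keep if_same. Qed.

Lemma keep_comp P Q x : keep P (keep Q x) = keep (predI P Q) x.
Proof. by apply/funext => i; rewrite /keep /=; case: (P i); case: (Q i). Qed.

Lemma keepC P Q x : keep P (keep Q x) = keep Q (keep P x).
Proof. by apply/funext => i; rewrite /keep /=; case: (P i); case: (Q i). Qed.

Lemma eq_keep P Q x : (forall i, x i != 0 -> P i = Q i) -> keep P x = keep Q x.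
Proof.
move=> PQ; apply/funext => i; rewrite /keep.
have [->|/PQ ->//] := eqVneq (x i) 0.
by rewrite !if_same.
Qed.

Lemma keep_id P x : (forall i, x i != 0 -> P i) -> keep P x = x.
Proof.
move=> PQ; apply/funext => i; rewrite /keep; case: ifPn => // /negP Pi.
by apply/esym/eqP/negP => /negP/PQ.
Qed.

Lemma keep_nil P x : (forall i, x i != 0 -> ~~ P i) -> keep P x = 0.
Proof.
move=> PQ; apply/funext => i; rewrite /keep; case: ifPn => // Pi.
by apply/eqP; move/contraLR: (PQ i); apply.
Qed.

Lemma keep_predC P x : x = keep P x + keep (predC P) x.
Proof.
by apply/funext => i; rewrite fctE /keep /=; case: (P i); rewrite ?addr0 ?add0r.
Qed.

End FinitelySupported.

(** * The implicit norm equation and unconditionality of the basis *)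

Section Norm.
Variables (R : realType) (N : (nat -> R) -> R).
Hypothesis hN : is_schlumprecht_norm N.
Local Notation f := (schlumprecht_f R).
Implicit Types (x y : nat -> R) (P Q : pred nat).

Lemma N_homog a x : c00 x -> N (a *: x) = `|a| * N x.
Proof. by case: hN => -[_ h _] _; exact: h. Qed.

Lemma N_triangle x y : c00 x -> c00 y -> N (x + y) <= N x + N y.
Proof. by case: hN => -[_ _ h] _; exact: h. Qed.

Lemma N0 : N 0 = 0.
Proof. by rewrite -(scale0r (0 : nat -> R)) N_homog ?normr0 ?mul0r//; exact: c000. Qed.

Lemma N_sum (I : Type) (r : seq I) (Q : pred I) (F : I -> nat -> R) :
  (forall i, Q i -> c00 (F i)) ->
  N (\sum_(i <- r | Q i) F i) <= \sum_(i <- r | Q i) N (F i).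
Proof.
move=> FQ; elim: r => [|i r IH]; first by rewrite !big_nil N0.
rewrite !big_cons; case: ifPn => // Qi.
apply: le_trans (N_triangle (FQ _ Qi) _) _; first exact: c00_sum.
by rewrite lerD2l.
Qed.

Lemma norm_coord_le x i : c00 x -> `|x i| <= N x.
Proof.
move=> cx; rewrite -lee_fin; case: hN => _ /(_ _ cx) ->.
by rewrite le_max ereal_sup_ubound//=; exists i.
Qed.

Lemma N_ge0 x : c00 x -> 0 <= N x.
Proof. by move=> /(norm_coord_le 0); exact: le_trans. Qed.

Lemma N_split n E x : c00 x -> (2 <= n)%N ->
  (forall i, (i.+1 < n)%N -> set_lt (E i) (E i.+1)) ->
  \sum_(i < n) N (coord_restr (E i) x) <= f n * N x.
Proof.
move=> cx n2 ltE; rewrite -ler_pdivrMl ?schlumprecht_f_gt0 ?(ltn_trans _ n2)//.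
rewrite -lee_fin; case: hN => _ /(_ _ cx) ->.
by rewrite le_max; apply/orP; right; apply: ereal_sup_ubound; exists n, E.
Qed.

Lemma N_le x c : c00 x -> (forall i, `|x i| <= c) ->
  (forall n E, (2 <= n)%N ->
     (forall i, (i.+1 < n)%N -> set_lt (E i) (E i.+1)) ->
     \sum_(i < n) N (coord_restr (E i) x) <= f n * c) ->
  N x <= c.
Proof.
move=> cx xc Ec; rewrite -lee_fin; case: hN => _ /(_ _ cx) ->.
rewrite ge_max; apply/andP; split; apply: ge_ereal_sup.
  by move=> _ [i _ <-]; rewrite lee_fin.
move=> _ [n [E [n2 ltE ->]]]; rewrite lee_fin.
by rewrite ler_pdivrMl ?schlumprecht_f_gt0 ?(ltn_trans _ n2)//; exact: Ec.
Qed.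

Lemma set_lt_trans (E : nat -> set nat) n :
  (forall i, (i.+1 < n)%N -> set_lt (E i) (E i.+1)) ->
  forall i j, (i < j < n)%N -> forall a b, E i a -> E j b -> (a < b)%N.
Proof.
move=> ltE i j /andP[ij]; elim: j ij => // j IH.
rewrite ltnS leq_eqVlt => /predU1P[<-|ij] jn a b Ea Eb.
  by have [_ _] := ltE _ jn; apply.
have [[c Ec] _ cb] := ltE _ jn.
apply: (ltn_trans (IH ij (ltnW jn) a c Ea Ec)); exact: cb.
Qed.

(** Induction on the number of nonzero coordinates: in the equation for [keep P x], every piece
    comes from a restriction of [x] with fewer coordinates, unless one set contains the whole
    support of [x]. *)
Lemma N_keep P x : c00 x -> N (keep P x) <= N x.
Proof.
move=> cx; have [M xM] := (c00P x).1 cx.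
pose mu y := (\sum_(i < M) (y i != 0%R :> R))%N.
have [k] := ubnP (mu x); elim: k => // k IH in x cx xM P *.
rewrite ltnS => muk.
have cPx := c00_keep P cx.
have Ng0 := N_ge0 cPx.
(* If one set contains the whole support, the equation only returns the norm in question, divided by
   [f n >= f 2 > 1]. The second entry of the maximum allows for this, and when it wins it forces
   [N (keep P x) = 0]. *)
suff : N (keep P x) <= Num.max (N x) (N (keep P x) / f 2).
  rewrite le_max => /orP[//|].
  have f2 := schlumprecht_f_ge32 R (leqnn 2).
  have f2' : 0 < f 2 by exact: schlumprecht_f_gt0.
  rewrite ler_pdivlMr// => h.
  have -> : N (keep P x) = 0 by nra.
  exact: N_ge0.
apply: N_le => // [i|n E n2 ltE].
  rewrite le_max (_ : `|keep P x i| <= N x)//.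
  by rewrite /keep; case: ifP => _; [exact: norm_coord_le|rewrite normr0 N_ge0].
have fn0 : 0 < f n by rewrite schlumprecht_f_gt0 ?(ltn_trans _ n2).
case: (pselect (exists i : 'I_n, coord_restr (E i) x = x)) => [[i Ex]|noE].
  apply: (@le_trans _ _ (f n * (N (keep P x) / f 2))); last first.
    by rewrite ler_pM2l// le_max lexx orbT.
  rewrite mulrA ler_pdivlMr ?schlumprecht_f_gt0// mulrC ler_pM//.
  - by rewrite ltW// schlumprecht_f_gt0.
  - by apply: sumr_ge0 => j _; apply: N_ge0; exact: c00_keep.
  - exact: schlumprecht_f_mono.
  rewrite (bigD1 i)//= big1 ?addr0 => [|j ji].
    by rewrite coord_restrE keepC -coord_restrE Ex.
  rewrite coord_restrE keepC (_ : keep (fun a => a \in E j) x = 0) ?keep0 ?N0//.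
  apply: keep_nil => a xa; apply/negP => /set_mem Ea.
  have {xa} /set_mem Eb : a \in E i.
    by apply: contraNT xa => Eb; rewrite -Ex coord_restrE /keep (negbTE Eb).
  have : (i < j)%N || (j < i)%N by rewrite -neq_ltn eq_sym.
  have jn := ltn_ord j; have in_ := ltn_ord i.
  move=> /orP[ij|ij].
    by have := set_lt_trans ltE (_ : (i < j < n)%N) Eb Ea; rewrite ij jn ltnn => /(_ isT).
  by have := set_lt_trans ltE (_ : (j < i < n)%N) Ea Eb; rewrite ij in_ ltnn => /(_ isT).
apply: (@le_trans _ _ (f n * N x)); last by rewrite ler_pM2l// le_max lexx.
apply: le_trans (N_split cx n2 ltE); apply: ler_sum => i _.
rewrite !coord_restrE keepC; apply: IH; first exact: c00_keep.
  by move=> j /xM xj; rewrite /keep xj if_same.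
apply: leq_trans muk; rewrite /mu ltn_neqAle; apply/andP; split; last first.
  by apply: leq_sum => j _; rewrite /keep; case: ifP; rewrite ?eqxx.
apply/negP => /eqP mueq; apply: noE; exists i.
apply/funext => j; rewrite coord_restrE.
have [Mj|jM] := leqP M j; first by rewrite /keep xM// if_same.
rewrite /keep; case: ifPn => // Eij; apply/esym/eqP/negP => /negP xj.
suff : (mu (keep (fun a => a \in E i) x) < mu x)%N by rewrite /mu mueq ltnn.
rewrite /mu (bigD1 (Ordinal jM))//= [in ltnRHS](bigD1 (Ordinal jM))//=.
rewrite {1}/keep (negbTE Eij) eqxx add0n xj add1n ltnS.
by apply: leq_sum => l _; rewrite /keep; case: ifP; rewrite ?eqxx.
Qed.

End Norm.

(** * Cutting a vector into successive pieces *)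

Section Cuts.
Variables (R : realType) (N : (nat -> R) -> R).
Hypothesis hN : is_schlumprecht_norm N.
Local Notation f := (schlumprecht_f R).
Implicit Types (x y z : nat -> R) (s : seq nat) (c : nat).

Definition lo c x : nat -> R := keep (fun i => (i < c)%N) x.
Definition hi c x : nat -> R := keep (fun i => (c <= i)%N) x.

Lemma c00_lo c x : c00 x -> c00 (lo c x). Proof. exact: c00_keep. Qed.
Lemma c00_hi c x : c00 x -> c00 (hi c x). Proof. exact: c00_keep. Qed.

Lemma lo_hi c x : x = lo c x + hi c x.
Proof.
rewrite {1}(keep_predC (fun i => (i < c)%N) x); congr (_ + _).
by apply: eq_keep => i _ /=; rewrite -leqNgt.
Qed.

(* The sum of the norms of the pieces of [x] cut at the points of [s]; a cut
   point smaller than an earlier one only contributes an empty piece. *)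
Fixpoint cutsum s x : R :=
  if s is c :: s' then N (lo c x) + cutsum s' (hi c x) else N x.

Lemma cutsum0 s : cutsum s 0 = 0.
Proof. by elim: s => [|c s IH] /=; rewrite ?N0// /lo /hi !keep0 N0 ?add0r. Qed.

Lemma cutsumD s x y : c00 x -> c00 y -> cutsum s (x + y) <= cutsum s x + cutsum s y.
Proof.
elim: s x y => [|c s IH] x y cx cy /=; first exact: N_triangle.
rewrite /lo /hi !keepD addrACA; apply: lerD.
  by apply: N_triangle => //; exact: c00_keep.
by apply: IH; exact: c00_keep.
Qed.

Lemma cutsum_sum s (I : Type) (r : seq I) (F : I -> nat -> R) :
  (forall i, c00 (F i)) ->
  cutsum s (\sum_(i <- r) F i) <= \sum_(i <- r) cutsum s (F i).
Proof.
move=> cF; elim: r => [|i r IH]; first by rewrite !big_nil cutsum0.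
rewrite !big_cons; apply: le_trans (cutsumD _ (cF _) _) _; first exact: c00_sum.
by rewrite lerD2l.
Qed.

Lemma cutsumZ s a x : c00 x -> cutsum s (a *: x) = `|a| * cutsum s x.
Proof.
elim: s x => [|c s IH] x cx /=; first exact: N_homog.
rewrite /lo /hi !keepZ (N_homog hN)// ?IH ?mulrDr//; exact: c00_keep.
Qed.

Lemma N_le_cutsum s x : c00 x -> N x <= cutsum s x.
Proof.
elim: s x => [|c s IH] x cx //=.
rewrite {1}(lo_hi c x); apply: le_trans (N_triangle hN _ _) _.
- exact: c00_lo.
- exact: c00_hi.
by rewrite lerD2l IH//; exact: c00_hi.
Qed.

Lemma cutsum_ge0 s x : c00 x -> 0 <= cutsum s x.
Proof. by move=> cx; apply: le_trans (N_le_cutsum s cx); exact: N_ge0. Qed.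

Lemma cutsum_le_chain M s x b : (forall i, x i != 0 -> (b <= i < M)%N) ->
  exists L : seq (set nat),
    [/\ (size L <= (size s).+1)%N,
        forall A, A \in L -> A !=set0 /\ A `<=` [set i | (b <= i < M)%N],
        forall i, (i.+1 < size L)%N -> set_lt (nth set0 L i) (nth set0 L i.+1)
      & cutsum s x <= \sum_(A <- L) N (coord_restr A x)].
Proof.
elim: s x b => [|c s IH] x b xb /=.
  have [x0|x0] := pselect (x = 0).
    by exists [::]; split => //; rewrite big_nil x0 N0.
  exists [:: supp x]; split => //.
    move=> A; rewrite inE => /eqP ->; split; last by move=> i /xb.
    apply: contra_notP x0 => /nonemptyPn x0; apply/funext => i.
    by apply/eqP/negP => /negP xi; have : supp x i by []; rewrite x0.
  rewrite big_seq1 coord_restrE keep_id// => i xi.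
  by apply/mem_set.
have hiP i : hi c x i != 0 -> (maxn b c <= i < M)%N.
  rewrite /hi /keep; case: ifPn => [ci /xb/andP[bi iM]|_]; rewrite ?eqxx//.
  by rewrite geq_max bi ci iM.
have [L [sL LP Lc Ls]] := IH _ _ hiP.
have Ls' : cutsum s (hi c x) <= \sum_(A <- L) N (coord_restr A x).
  apply: le_trans Ls _; rewrite big_seq [leRHS]big_seq; apply: ler_sum => A AL.
  rewrite coord_restrE /hi keep_comp coord_restrE (_ : keep _ _ = keep (fun i => i \in A) x)//.
  apply: eq_keep => i _ /=; apply: andb_idr => /set_mem /(LP _ AL).2/=.
  by rewrite geq_max -andbA => /and3P[].
have LP' A : A \in L -> A !=set0 /\ A `<=` [set i | (b <= i < M)%N].
  move=> /LP[A0 Ab]; split => // i /Ab/=.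
  by rewrite geq_max => /andP[/andP[-> _] ->].
have [x0|x0] := pselect (lo c x = 0).
  by exists L; rewrite x0 N0// add0r; split => //; exact: (leq_trans sL).
have supplo i : supp (lo c x) i -> (b <= i < M)%N /\ (i < c)%N.
  rewrite /supp/= /lo /keep; case: ifPn => [ic /xb|_]; rewrite ?eqxx//.
have supp0 : supp (lo c x) !=set0.
  apply: contra_notP x0 => /nonemptyPn x0; apply/funext => i.
  by apply/eqP/negP => /negP xi; have : supp (lo c x) i by []; rewrite x0.
exists (supp (lo c x) :: L); split => //=.
- move=> A; rewrite inE => /predU1P[->|]; last exact: LP'.
  by split => // i /supplo[].
- move=> [|i]; last exact: Lc.
  rewrite ltnS => L0; have [A0 AP] := LP _ (mem_nth set0 L0).
  split => // i j /supplo[_ ic] /AP/=; rewrite geq_max => /andP[/andP[_ cj] _].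
  exact: leq_trans cj.
rewrite big_cons lerD//.
rewrite coord_restrE (_ : keep _ x = lo c x)//.
apply: eq_keep => i xi; apply/idP/idP => [/set_mem/supplo[]//|ic].
by apply/mem_set; rewrite /supp /= /lo /keep ic.
Qed.

Lemma cutsum_le s x : c00 x -> cutsum s x <= f (size s).+1 * N x.
Proof.
case: s => [|c s] cx; first by rewrite schlumprecht_f1 mul1r.
have [M xM] := (c00P x).1 cx.
have xb i : x i != 0 -> (0 <= i < M)%N.
  by move=> xi; rewrite /= ltnNge; apply: contra xi => /xM ->.
have [L [sL LP Lc Ls]] := cutsum_le_chain (c :: s) xb.
apply: (le_trans Ls); set n := (size (c :: s)).+1 in sL *.
(* The norm equation asks for exactly [n] nonempty sets, but empty pieces were dropped from [L];
   singletons beyond the support of [x] fill it up. *)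
pose E i := if (i < size L)%N then nth set0 L i else [set (M + i)%N].
have ltE i : (i.+1 < n)%N -> set_lt (E i) (E i.+1).
  move=> _; rewrite /E; have [iL|iL] := ltnP i.+1 (size L).
    by rewrite (ltnW iL); exact: Lc.
  case: ifPn => [iL'|_].
    have [A0 AP] := LP _ (mem_nth set0 iL'); split => //; first by exists (M + i.+1)%N.
    by move=> a b /AP/= aM ->; lia.
  split; [by exists (M + i)%N|by exists (M + i.+1)%N|].
  by move=> a b -> ->; lia.
have n2 : (2 <= n)%N by [].
apply: le_trans (N_split hN cx n2 ltE).
rewrite (big_nth set0) -(big_mkord xpredT (fun i => N (coord_restr (E i) x))).
rewrite [leRHS](big_cat_nat (n := size L))//=; apply: ler_wpDr.
  by apply: sumr_ge0 => i _; apply: N_ge0 => //; exact: c00_keep.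
apply: ler_sum_nat => i /andP[_ iL].
by rewrite /E iL.
Qed.

(** By unconditionality the sets may be enlarged to successive intervals; the cut points are the
    minima of [E 1], ..., [E n]. *)
Lemma chain_le_cutsum n x (E : nat -> set nat) : c00 x ->
  (forall i, (i < n)%N -> set_lt (E i) (E i.+1)) ->
  exists2 s, size s = n & \sum_(i < n.+1) N (coord_restr (E i) x) <= cutsum s x.
Proof.
elim: n x E => [|n IH] x E cx ltE.
  by exists [::]; rewrite // big_ord1 /= N_keep.
have [c0 Ec0] : E 1 !=set0 by have [] := ltE 0 isT.
have exE : exists c, c \in E 1 by exists c0; exact/mem_set.
case: (ex_minnP exE) => c /set_mem Ec cmin.
have [s sn le_s] := IH (hi c x) (fun i => E i.+1) (c00_hi c cx)
  (fun i (h : (i < n)%N) => ltE i.+1 h).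
exists (c :: s); first by rewrite /= sn.
rewrite big_ord_recl /=; apply: lerD.
  rewrite coord_restrE (_ : keep _ x = keep (fun i => i \in E 0) (lo c x)).
    by apply: N_keep => //; exact: c00_lo.
  rewrite /lo keep_comp; apply: eq_keep => i _ /=.
  apply/esym; apply: andb_idr => /set_mem E0i.
  by have [_ _] := ltE 0 isT; apply.
apply: le_trans le_s; apply: ler_sum => i _; rewrite /bump add1n.
rewrite !coord_restrE (_ : keep _ x = keep (fun a => a \in E i.+1) (hi c x))//.
rewrite /hi keep_comp; apply: eq_keep => a _ /=.
apply/esym; apply: andb_idr => Ea.
case: i Ea => -[|i] /= ilt Ea; first exact: cmin.
apply/ltnW; apply: (set_lt_trans (E := E) (n := n.+2) _ (i := 1) (j := i.+2)) => //.
exact: set_mem.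
Qed.

(** Together with [cutsum_le] this replaces chains of sets by lists of cut points: a node of arity
    [n] is a list of size [n - 1]. *)
Lemma N_le_cut x b : c00 x -> (forall i, `|x i| <= b) ->
  (forall s, (0 < size s)%N -> cutsum s x <= f (size s).+1 * b) -> N x <= b.
Proof.
move=> cx xb sb; apply: (N_le hN) => // -[|[|n]]// E _ ltE.
have [|s sn le_s] := @chain_le_cutsum n.+1 x E cx; first by move=> i; exact: ltE.
by apply: (le_trans le_s); rewrite -sn sb// sn.
Qed.

(** Capping [s1] at [c] keeps its cuts off [hi c x]; one further cut at [c] separates the two
    lists. *)
Lemma cutsum_cat c s1 s2 x : c00 x ->
  cutsum s1 (lo c x) + cutsum s2 (hi c x) <= cutsum (map (minn c) s1 ++ c :: s2) x.
Proof.
elim: s1 x => [|c1 s1 IH] x cx //=.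
have -> : lo c1 (lo c x) = lo (minn c c1) x.
  rewrite /lo keep_comp; apply: eq_keep => i _ /=; rewrite leq_min.
  by rewrite andbC.
rewrite -addrA lerD2l.
have := IH (hi (minn c c1) x) (c00_hi _ cx); apply: le_trans; apply: lerD.
  rewrite (_ : hi c1 (lo c x) = lo c (hi (minn c c1) x))//.
  rewrite /lo /hi !keep_comp; apply: eq_keep => i _ /=; lia.
rewrite (_ : hi c x = hi c (hi (minn c c1) x))//.
by rewrite /lo /hi !keep_comp; apply: eq_keep => i _ /=; lia.
Qed.

Lemma cutsum_filter_ge e s x : (forall i, x i != 0 -> (e <= i)%N) ->
  cutsum s x = cutsum [seq c <- s | (e < c)%N] x.
Proof.
elim: s x => [|c s IH] x xe //=.
have he : forall i, hi c x i != 0 -> (e <= i)%N.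
  by move=> i; rewrite /hi /keep; case: ifP => [_ /xe//|]; rewrite eqxx.
case: ifPn => [ec|]; first by rewrite /= IH.
rewrite -leqNgt => ce.
rewrite (_ : lo c x = 0) ?N0// ?add0r; last first.
  by apply: keep_nil => i /xe; lia.
by rewrite (_ : hi c x = x) ?IH//; apply: keep_id => i /xe; lia.
Qed.

Lemma cutsum_filter_lt e s x : c00 x -> (forall i, x i != 0 -> (i < e)%N) ->
  cutsum s x <= cutsum [seq c <- s | (c <= e)%N] x.
Proof.
elim: s x => [|c s IH] x cx xe //=.
have he : forall i, hi c x i != 0 -> (i < e)%N.
  by move=> i; rewrite /hi /keep; case: ifP => [_ /xe//|]; rewrite eqxx.
case: ifPn => [ec|]; first by rewrite /= lerD2l IH//; exact: c00_hi.
rewrite -ltnNge => ce.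
rewrite (_ : hi c x = 0) ?cutsum0 ?addr0; last first.
  by apply: keep_nil => i /xe; lia.
rewrite (_ : lo c x = x) ?N_le_cutsum//; apply: keep_id => i /xe; lia.
Qed.

Lemma cutsum_single s x j : (forall i, x i != 0 -> i = j) -> cutsum s x = N x.
Proof.
elim: s x => [|c s IH] x xj //=.
have [jc|cj] := ltnP j c.
  rewrite (_ : hi c x = 0) ?cutsum0 ?addr0; last first.
    by apply: keep_nil => i /xj; lia.
  by rewrite (_ : lo c x = x)//; apply: keep_id => i /xj; lia.
rewrite (_ : lo c x = 0) ?N0// ?add0r; last first.
  by apply: keep_nil => i /xj; lia.
by rewrite (_ : hi c x = x) ?IH//; apply: keep_id => i /xj; lia.
Qed.

(** A vector with a single coordinate is never really cut, so the sum of the norms of the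
    coordinates bounds all cuts at once. Hence [Gam] is a finite supremum, and a fixed vector is
    negligible against [f n] at large arity [n]. *)
Lemma cutsum_bounded x : c00 x -> exists B, forall s, cutsum s x <= B.
Proof.
move=> cx; have [M xM] := (c00P x).1 cx.
exists (\sum_(i < M) N (keep (fun j => j == i :> nat) x)) => s.
rewrite {1}(_ : x = \sum_(i < M) keep (fun j => j == i :> nat) x); last first.
  apply/funext => j; rewrite fct_sumE.
  have [Mj|jM] := leqP M j.
    by rewrite xM// big1// => i _; rewrite /keep xM// if_same.
  rewrite (bigD1 (Ordinal jM))//= big1 ?addr0 => [|i].
    by rewrite /keep eqxx.
  by rewrite -val_eqE /= /keep /= eq_sym => /negbTE ->.
apply: le_trans (cutsum_sum _ _ _) _; first by move=> i; exact: c00_keep.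
apply: ler_sum => i _; rewrite (@cutsum_single _ _ i)// => j.
by rewrite /keep; have [->|_] := eqVneq j (i : nat); rewrite ?eqxx.
Qed.

(** Fewer than [m] cuts make at most [m] pieces. At [m = 0] the supremum is over the empty set,
    hence the conditions [0 < m] below. *)
Definition Gam m x : R := sup [set cutsum s x | s in [set s | (size s < m)%N]].

Lemma Gam_ub m s x : c00 x -> (size s < m)%N -> cutsum s x <= Gam m x.
Proof.
move=> cx sm; apply: ub_le_sup; last by exists s.
have [B xB] := cutsum_bounded cx.
by exists B => _ [t _ <-].
Qed.

Lemma Gam_le m x b : (0 < m)%N ->
  (forall s, (size s < m)%N -> cutsum s x <= b) -> Gam m x <= b.
Proof.
move=> m0 sb; apply: ge_sup; first by exists (cutsum [::] x), [::].
by move=> _ [s sm <-]; exact: sb.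
Qed.

Lemma Gam1 x : c00 x -> Gam 1 x = N x.
Proof.
move=> cx; apply/eqP; rewrite eq_le; apply/andP; split.
  by apply: Gam_le => // -[].
exact: (@Gam_ub 1 [::]).
Qed.

Lemma Gam_mono m m' x : c00 x -> (0 < m <= m')%N -> Gam m x <= Gam m' x.
Proof.
move=> cx /andP[m0 mm']; apply: Gam_le => // s sm.
by apply: Gam_ub => //; exact: leq_trans mm'.
Qed.

Lemma N_le_Gam m x : c00 x -> (0 < m)%N -> N x <= Gam m x.
Proof. by move=> cx m0; rewrite -Gam1// Gam_mono. Qed.

Lemma Gam_ge0 m x : c00 x -> (0 < m)%N -> 0 <= Gam m x.
Proof. by move=> cx m0; apply: le_trans (N_le_Gam cx m0); exact: N_ge0. Qed.

(** Pieces are counted for as long as possible and paid for only here: as [f] is logarithmic, a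
    product of arities costs far less than the product of their values under [f]. *)
Lemma Gam_bound m x : c00 x -> (0 < m)%N -> Gam m x <= f m * N x.
Proof.
move=> cx m0; apply: Gam_le => // s sm.
apply: le_trans (cutsum_le _ cx) _.
by apply: ler_wpM2r; [exact: N_ge0|exact: schlumprecht_f_mono].
Qed.

Lemma Gam_cutZ m a x : c00 x -> (0 < m)%N -> `|a| * Gam m x <= Gam m (a *: x).
Proof.
move=> cx m0; have [->|a0] := eqVneq a 0.
  by rewrite normr0 mul0r Gam_ge0//; exact: c00Z.
rewrite -ler_pdivlMl ?normr_gt0//; apply: Gam_le => // s sm.
rewrite ler_pdivlMl ?normr_gt0// -cutsumZ//; apply: Gam_ub => //.
exact: c00Z.
Qed.

Lemma Gam_add m1 m2 c x : c00 x -> (0 < m1)%N -> (0 < m2)%N ->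
  Gam m1 (lo c x) + Gam m2 (hi c x) <= Gam (m1 + m2) x.
Proof.
move=> cx m10 m20; rewrite -lerBrDr; apply: Gam_le => // s1 s1m.
rewrite lerBrDr -lerBrDl; apply: Gam_le => // s2 s2m.
rewrite lerBrDl; apply: le_trans (cutsum_cat _ _ _ cx) _; apply: Gam_ub => //.
by rewrite size_cat size_map /=; lia.
Qed.

End Cuts.

(** * Domination between block sequences *)

Section Blocks.
Variables (R : realType) (N : (nat -> R) -> R).
Hypothesis hN : is_schlumprecht_norm N.
Local Notation f := (schlumprecht_f R).

Lemma cutsum_keep s (P : pred nat) x : c00 x ->
  cutsum N s (keep P x) <= cutsum N s x.
Proof.
elim: s x => [|c s IH] x cx /=; first exact: N_keep.
have -> : lo c (keep P x) = keep P (lo c x) by exact: keepC.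
have -> : hi c (keep P x) = keep P (hi c x) by exact: keepC.
by apply: lerD; [apply: N_keep => //; exact: c00_lo|apply: IH; exact: c00_hi].
Qed.

Lemma Gam_keep m (P : pred nat) x : c00 x -> (0 < m)%N ->
  Gam N m (keep P x) <= Gam N m x.
Proof.
move=> cx m0; apply: Gam_le => // s sm.
by apply: le_trans (cutsum_keep _ _ cx) _; exact: Gam_ub.
Qed.

(** Only points separating the supports are recorded, so that [p \o psi] serves the subsequence
    along [psi]. *)
Definition blocks (p : nat -> nat) (Y : nat -> nat -> R) :=
  [/\ forall i, c00 (Y i), forall i, N (Y i) = 1,
      {homo p : i j / (i <= j)%N}
    & forall i t, Y i t != 0 -> (p i <= t < p i.+1)%N].

Definition bsum (a : nat -> R) (Y : nat -> nat -> R) l r : nat -> R :=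
  \sum_(l <= i < r) a i *: Y i.

Section OneSequence.
Variables (p : nat -> nat) (Y : nat -> nat -> R) (a : nat -> R).
Hypothesis hY : blocks p Y.

Lemma c00_bsum l r : c00 (bsum a Y l r).
Proof. by apply: c00_sum => i _; apply: c00Z; case: hY. Qed.

Lemma bsum_cat l i r : (l <= i <= r)%N ->
  bsum a Y l r = bsum a Y l i + bsum a Y i r.
Proof. by move=> /andP[li ir]; rewrite /bsum (big_cat_nat (n := i)). Qed.

Lemma bsum1 i : bsum a Y i i.+1 = a i *: Y i.
Proof. by rewrite /bsum big_nat1. Qed.

Lemma bsum_nil l r : (r <= l)%N -> bsum a Y l r = 0.
Proof. by move=> rl; rewrite /bsum big_geq. Qed.

Lemma bsum_supp l r t : bsum a Y l r t != 0 -> (p l <= t < p r)%N.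
Proof.
have [_ _ hp Yp] := hY; move=> bt.
have [i /andP[li ir] /Yp/andP[pit tpi]] : exists2 i, (l <= i < r)%N & Y i t != 0.
  apply: contrapT => noi; move/negP: bt; apply; apply/eqP.
  rewrite /bsum fct_sumE big_nat_cond big1// => i /andP[lir _].
  rewrite -[LHS]/(a i * Y i t); have [->|Yit] := eqVneq (Y i t) 0; first by rewrite mulr0.
  by exfalso; apply: noi; exists i.
by rewrite (leq_trans (hp _ _ li) pit) (leq_trans tpi (hp _ _ ir)).
Qed.

Lemma lo_bsum l i r : (l <= i <= r)%N -> lo (p i) (bsum a Y l r) = bsum a Y l i.
Proof.
move=> lir; rewrite (bsum_cat lir) /lo keepD keep_id => [|t /bsum_supp]; last by lia.
by rewrite keep_nil ?addr0// => t /bsum_supp; lia.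
Qed.

Lemma hi_bsum l i r : (l <= i <= r)%N -> hi (p i) (bsum a Y l r) = bsum a Y i r.
Proof.
move=> lir; rewrite (bsum_cat lir) /hi keepD keep_nil => [|t /bsum_supp]; last by lia.
by rewrite keep_id ?add0r// => t /bsum_supp; lia.
Qed.

Lemma N_bsum_sub l l' r r' : (l <= l' <= r')%N -> (r' <= r)%N ->
  N (bsum a Y l' r') <= N (bsum a Y l r).
Proof.
move=> ll' r'r; rewrite -(@lo_bsum l' r' r) -?(@hi_bsum l l' r); try lia.
have cb := c00_bsum l r.
by apply: le_trans (N_keep hN _ (c00_hi _ cb)) _; exact: N_keep.
Qed.

Lemma norm_coef_le l i r : (l <= i < r)%N -> `|a i| <= N (bsum a Y l r).
Proof.
move=> /andP[li ir]; have [cY NY _ _] := hY.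
by rewrite -[`|a i|]mulr1 -(NY i) -(N_homog hN)// -bsum1 N_bsum_sub//; lia.
Qed.

Lemma Gam_bsum_add m1 m2 l i r : (l <= i <= r)%N -> (0 < m1)%N -> (0 < m2)%N ->
  Gam N m1 (bsum a Y l i) + Gam N m2 (bsum a Y i r) <= Gam N (m1 + m2) (bsum a Y l r).
Proof.
move=> lir m10 m20; rewrite -(lo_bsum lir) -(hi_bsum lir).
by apply: Gam_add => //; exact: c00_bsum.
Qed.

Lemma Gam_bsum_suffix m l i r : (l <= i <= r)%N -> (0 < m)%N ->
  Gam N m (bsum a Y i r) <= Gam N m (bsum a Y l r).
Proof.
move=> lir m10; rewrite -(hi_bsum lir); apply: Gam_keep => //.
exact: c00_bsum.
Qed.

Lemma norm_bsum_coord l r t : exists2 b, `|bsum a Y l r t| <= b &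
  b = 0 \/ exists2 i, (l <= i < r)%N & b = `|a i|.
Proof.
have [cY NY hp Yp] := hY.
have [[i lir Yit]|noi] := pselect (exists2 i, (l <= i < r)%N & Y i t != 0); last first.
  exists 0; last by left.
  rewrite /bsum fct_sumE big_nat_cond big1 ?normr0// => i /andP[lir _].
  rewrite -[LHS]/(a i * Y i t); have [->|Yit] := eqVneq (Y i t) 0; first by rewrite mulr0.
  by exfalso; apply: noi; exists i.
exists `|a i|; last by right; exists i.
rewrite /bsum fct_sumE (bigD1_seq i) ?mem_index_iota ?iota_uniq//=.
rewrite big1 ?addr0 => [|j ji].
  rewrite -[X in `|X|]/(a i * Y i t) normrM ler_piMr// -(NY i).
  exact: norm_coord_le.
rewrite -[LHS]/(a j * Y j t); have [->|Yjt] := eqVneq (Y j t) 0; first by rewrite mulr0.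
have := Yp _ _ Yit; have := Yp _ _ Yjt.
have [ij|ij|ij] := ltngtP i j; last by rewrite ij eqxx in ji.
  by have := hp _ _ ij; lia.
by have := hp _ _ ij; lia.
Qed.

End OneSequence.

End Blocks.

Section Split.
Variables (R : realType) (N : (nat -> R) -> R).
Hypothesis hN : is_schlumprecht_norm N.
Local Notation f := (schlumprecht_f R).
Variables (p q : nat -> nat) (Y Z : nat -> nat -> R) (a : nat -> R).
Hypotheses (hY : blocks N p Y) (hZ : blocks N q Z).
Local Notation X l r := (N (bsum a Y l r)).
Local Notation X' l r := (N (bsum a Z l r)).
Local Notation G m l r := (Gam N m (bsum a Z l r)).

Let cY l r : c00 (bsum a Y l r) := c00_bsum a hY l r.
Let cZ l r : c00 (bsum a Z l r) := c00_bsum a hZ l r.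

(* Peel off the first piece: it cuts at most one of the vectors [Y i], and the
   pieces of this [Y i] are compared with as many pieces of [Z i]. *)
Lemma cutsum_bsum_le (b1 b2 b3 : R) (m1 m2 m3 n rmax : nat) :
  2 <= b1 -> 0 <= b2 -> 0 <= b3 -> (0 < m1)%N -> (0 < m2)%N -> (0 < m3)%N ->
  (forall l r, (l <= r <= rmax)%N ->
    X l r <= b1 * G m1 l r + b2 * G m2 l r + b3 * G m3 l r) ->
  forall s l r, (size s < n)%N -> (l <= r <= rmax)%N ->
    (forall i, (l <= i < r)%N -> forall m, (0 < m <= n)%N ->
       Gam N m (Y i) <= 2 * Gam N m (Z i)) ->
  cutsum N s (bsum a Y l r) <=
    b1 * G (3 * (size s).+1 * m1)%N l r + b2 * G ((size s).+1 * m2)%N l r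
    + b3 * G ((size s).+1 * m3)%N l r.
Proof.
move=> b1_2 b2_0 b3_0 m10 m20 m30 hX.
have b1_0 : 0 <= b1 by lra.
have main k : forall s l r, (size s <= k)%N -> (size s < n)%N -> (l <= r <= rmax)%N ->
    (forall i, (l <= i < r)%N -> forall m, (0 < m <= n)%N ->
       Gam N m (Y i) <= 2 * Gam N m (Z i)) ->
  cutsum N s (bsum a Y l r) <=
    b1 * G (3 * (size s).+1 * m1)%N l r + b2 * G ((size s).+1 * m2)%N l r
    + b3 * G ((size s).+1 * m3)%N l r; last by move=> s l r; exact: (main (size s)).
have base (s : seq nat) l r : (l <= r <= rmax)%N -> X l r <=
    b1 * G (3 * (size s).+1 * m1)%N l r + b2 * G ((size s).+1 * m2)%N l r
    + b3 * G ((size s).+1 * m3)%N l r.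
  move=> lr; apply: le_trans (hX _ _ lr) _.
  by do 2?apply: lerD; apply: ler_wpM2l => //; apply: Gam_mono => //; nia.
elim: k => [|k IH] [|c s] l r sk sn lr YZ; [exact: (base [::])| |exact: (base [::])|].
  by rewrite /= in sk.
rewrite /= in sk sn *.
have [[j0 hj0]|noj] := pselect (exists j, (l <= j < r)%N && (c < p j.+1)%N); last first.
  have hc t : bsum a Y l r t != 0 -> (t < c)%N.
    case: (ltnP l r) => [lr'|rl]; last by rewrite bsum_nil// eqxx.
    move=> /(bsum_supp hY)/andP[_ tp]; apply: (leq_trans tp).
    rewrite leqNgt; apply/negP => cp; apply: noj; exists r.-1.
    by rewrite prednK ?cp ?andbT; lia.
  rewrite /lo keep_id// /hi keep_nil ?cutsum0 ?addr0; last 2 first.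
  - by [].
  - by move=> t /hc; lia.
  exact: (base (c :: s)).
have exj : exists j, (l <= j < r)%N && (c < p j.+1)%N by exists j0.
(* [Y i] is the only vector that the cut [c] can split: by minimality of [i] the earlier ones end by
   [c], and the later ones begin past [c]. *)
case: (ex_minnP exj) => i /andP[/andP[li ir] cpi] imin {j0 hj0 exj}.
have pic : (l < i)%N -> (p i <= c)%N.
  case: i li ir cpi imin => // i li ir cpi imin li'.
  rewrite leqNgt; apply/negP => cp; have := imin i; rewrite cp andbT ltnn => himin.
  by have /himin : (l <= i < r)%N by lia.
pose w := a i *: Y i.
have cw : c00 w by apply: c00Z; case: hY.
have wE : w = bsum a Y i i.+1 by rewrite bsum1.
have wp t : w t != 0 -> (p i <= t < p i.+1)%N by rewrite wE => /(bsum_supp hY).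
have bE : bsum a Y l r = bsum a Y l i + w + bsum a Y i.+1 r.
  by rewrite (@bsum_cat _ _ _ l i r) ?(@bsum_cat _ _ _ i i.+1 r) ?addrA ?wE//; lia.
have loE : lo c (bsum a Y l r) = bsum a Y l i + lo c w.
  rewrite bE /lo !keepD [W in _ + W]keep_nil ?addr0; last first.
    by move=> t /(bsum_supp hY); lia.
  congr (_ + _); apply: keep_id => t.
  case: (ltnP l i) => [li'|il]; last by rewrite bsum_nil// eqxx.
  by move=> /(bsum_supp hY); have := pic li'; lia.
have hiE : hi c (bsum a Y l r) = hi c w + bsum a Y i.+1 r.
  rewrite bE /hi !keepD [W in W + _ + _]keep_nil ?add0r; last first.
    move=> t; case: (ltnP l i) => [li'|il]; last by rewrite bsum_nil// eqxx.
    by move=> /(bsum_supp hY); have := pic li'; lia.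
  by congr (_ + _); apply: keep_id => t /(bsum_supp hY); lia.
pose s1 := [seq c <- s | (c <= p i.+1)%N].
pose s2 := [seq c <- s | (p i.+1 < c)%N].
have s12 : (size s1 + size s2 = size s)%N.
  rewrite /s1 /s2 !size_filter -[RHS](count_predC (fun c => (c <= p i.+1)%N)).
  by congr (_ + _)%N; apply: eq_count => z /=; rewrite ltnNge.
have h1 : N (lo c w) + cutsum N s (hi c w) <= b1 * G (size s1).+2 i i.+1.
  apply: (@le_trans _ _ (cutsum N (c :: s1) w)).
    rewrite /= lerD2l; apply: cutsum_filter_lt => //; first exact: c00_hi.
    by move=> t; rewrite /hi /keep; case: ifP => [_ /wp|_]; [lia|rewrite eqxx].
  have [cYi _ _ _] := hY; have [cZi _ _ _] := hZ.
  rewrite cutsumZ// bsum1.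
  apply: (@le_trans _ _ (`|a i| * (2 * Gam N (size s1).+2 (Z i)))).
    apply: ler_wpM2l => //; apply: (@le_trans _ _ (Gam N (size s1).+2 (Y i))).
      exact: Gam_ub.
    by apply: YZ; lia.
  rewrite mulrCA; apply: ler_pM => //; last exact: Gam_cutZ.
  by apply: mulr_ge0 => //; apply: Gam_ge0.
have h2 : cutsum N s (bsum a Y i.+1 r) <= b1 * G (3 * (size s2).+1 * m1)%N i.+1 r
    + b2 * G ((size s2).+1 * m2)%N i.+1 r + b3 * G ((size s2).+1 * m3)%N i.+1 r.
  rewrite (cutsum_filter_ge hN s (e := p i.+1)); last first.
    by move=> t /(bsum_supp hY)/andP[].
  have s2k : (size s2 <= k)%N by lia.
  have s2n : (size s2 < n)%N by lia.
  apply: (IH _ _ _ s2k s2n); first by lia.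
  by move=> j jr m mn; apply: YZ; lia.
have h0 : X l i <= b1 * G m1 l i + b2 * G m2 l i + b3 * G m3 l i.
  by apply: hX; lia.
have step m : (0 < m)%N -> G m l i + G ((size s2).+1 * m)%N i.+1 r
    <= G ((size s).+2 * m)%N l r.
  move=> m0; apply: (@le_trans _ _ (G m l i + G ((size s2).+1 * m)%N i r)).
    by rewrite lerD2l; apply: (Gam_bsum_suffix hN a hZ); nia.
  apply: le_trans (Gam_bsum_add hN a hZ _ _ _) _; try nia.
  by apply: Gam_mono => //; nia.
(* The count behind the factor 3: [m1] pieces before the split vector, [size s1 + 2] pieces of it,
   and [3 * (size s2 + 1) * m1] after it, where [size s1 + size s2 = size s]. *)
have step1 : G m1 l i + G (size s1).+2 i i.+1 + G (3 * (size s2).+1 * m1)%N i.+1 r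
    <= G (3 * (size s).+2 * m1)%N l r.
  apply: (@le_trans _ _ (G (m1 + (size s1).+2)%N l i.+1 + G (3 * (size s2).+1 * m1)%N i.+1 r)).
    by rewrite lerD2r; apply: (Gam_bsum_add hN a hZ); lia.
  apply: le_trans (Gam_bsum_add hN a hZ _ _ _) _; try nia.
  by apply: Gam_mono => //; nia.
have tri : N (lo c (bsum a Y l r)) <= X l i + N (lo c w).
  by rewrite loE; apply: N_triangle => //; exact: c00_lo.
have thi : cutsum N s (hi c (bsum a Y l r)) <=
    cutsum N s (hi c w) + cutsum N s (bsum a Y i.+1 r).
  by rewrite hiE; apply: cutsumD => //; exact: c00_hi.
have := ler_wpM2l b1_0 step1; have := ler_wpM2l b2_0 (step _ m20).
have := ler_wpM2l b3_0 (step _ m30); rewrite !mulrDr.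
lra.
Qed.

End Split.

(** Origin of the exponent [2 ^ l + 2] in [expand_bound]: here [v = 2 ^ (2 ^ l)], and the factor 4
    pays for tripling the pieces and for one more piece, the early part of the sum. *)
Lemma small_arity_count n u v : (n < v)%N -> (0 < u)%N ->
  (1 + 3 * n * u <= v * 4 * u)%N.
Proof.
move=> nv u0; have := leq_mul nv (leqnn (4 * u)); rewrite !mulnA; apply: leq_trans.
by nia.
Qed.

Lemma triple_arity_lt n e : (n < 2 ^ e.+1)%N -> (3 * n < 2 ^ (e + 3))%N.
Proof. by rewrite addn3 !expnS; lia. Qed.

(* The loss of one step of [tower_step], with [T = 2^l], [x = l] and
   [2^e <= n < 2^(e+1)], where [n] is the arity of the node. *)
Lemma level_arith (R : realFieldType) (T x e A C : R) :
  1024 <= T -> 0 <= x -> 32 * (x + 8) <= T -> T ^+ 2 <= e -> 0 <= C -> A <= C ->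
  (A + C * (8 * (x + 1 + 8) / (2 * T))) * (e + 3 + 2 * x * (T + 2))
  + (C * (2 / T)) * (e + 1 + (4 * T ^+ 2 + 2 + 2 * x * T))
  <= (A + C * (8 * (x + 8) / T)) * e.
Proof.
move=> T1 x0 xT Te C0 AC.
have T0 : 0 < T by lra.
set u := T^-1.
have Tu : T * u = 1 by rewrite mulfV// gt_eqF.
have u0 : 0 < u by rewrite invr_gt0.
rewrite (_ : 8 * (x + 1 + 8) / (2 * T) = 4 * (x + 9) * u); last first.
  by rewrite /u; field; rewrite gt_eqF.
have h1 : 4 * (x + 9) * u <= 1.
  have : 4 * (x + 9) * u <= T * u by apply: ler_wpM2r; [exact: ltW|lra].
  by rewrite Tu.
have p0 : 0 <= 3 + 2 * x * (T + 2) by nra.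
have AC2 : A + C * (4 * (x + 9) * u) <= 2 * C.
  have := ler_wpM2l C0 h1; rewrite mulr1; lra.
have k1 := ler_wpM2r p0 AC2.
have e0 : 0 <= e by apply: le_trans Te; rewrite exprn_ge0// ltW.
have key : 2 * T * (3 + 2 * x * (T + 2)) + 2 * (e + 1 + (4 * T ^+ 2 + 2 + 2 * x * T))
   <= 4 * (x + 7) * e.
  have xe : x * T ^+ 2 <= x * e by exact: ler_wpM2l.
  have xTT : x * T <= T * T by apply: ler_wpM2r; lra.
  have TT : 1024 * T <= T * T by apply: ler_wpM2r; lra.
  rewrite expr2 in xe Te *; lra.
have := ler_wpM2l (mulr_ge0 C0 (ltW u0)) key.
have -> : C * u * (2 * T * (3 + 2 * x * (T + 2)) +
    2 * (e + 1 + (4 * T ^+ 2 + 2 + 2 * x * T))) =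
  2 * C * (3 + 2 * x * (T + 2)) +
    C * (2 * u) * (e + 1 + (4 * T ^+ 2 + 2 + 2 * x * T)).
  rewrite -[2 * C * _]mulr1 -Tu; ring.
rewrite -/u => k2; lra.
Qed.

(** * Descent through the arities of a norming tree, with an a priori constant *)

Section Recursion.
Variables (R : realType) (N : (nat -> R) -> R).
Hypothesis hN : is_schlumprecht_norm N.
Local Notation f := (schlumprecht_f R).
Variables (p q : nat -> nat) (Y Z : nat -> nat -> R).
Hypotheses (hY : blocks N p Y) (hZ : blocks N q Z).
Variables (K : R) (kappa : nat -> nat).
Hypothesis good_Gam : forall n i m, (2 <= n)%N -> (kappa n <= i)%N ->
  (0 < m <= n)%N -> Gam N m (Y i) <= 2 * Gam N m (Z i).
Hypothesis bad_cutsum : forall a s l k, (0 < size s)%N ->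
  (l <= k <= kappa (size s).+1)%N ->
  cutsum N s (bsum a Y l k) <= K * f (size s).+1 * N (bsum a Z l k).
Variable A : R.
Hypotheses (A2 : 2 <= A) (K0 : 0 <= K) (KA : K <= A).

Section FixedCoefficients.
Variable a : nat -> R.
Local Notation NY l r := (N (bsum a Y l r)).
Local Notation NZ l r := (N (bsum a Z l r)).
Local Notation G m l r := (Gam N m (bsum a Z l r)).

Let cY l r : c00 (bsum a Y l r) := c00_bsum a hY l r.
Let cZ l r : c00 (bsum a Z l r) := c00_bsum a hZ l r.

(** At a node of arity [n] the sum is split at [kappa n], clamped to [[l, r]]. The [f n] in
    [bad_cutsum] cancels, so the early head costs [K] times its own norm, and only a tail of vectors
    with good profiles is left to be cut. *)
Lemma N_bsum_le l r b : (l <= r)%N -> NZ l r <= b ->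
  (forall s k, (0 < size s)%N -> (l <= k <= r)%N ->
    (forall i, (k <= i < r)%N -> (kappa (size s).+1 <= i)%N) ->
    K * NZ l k + (f (size s).+1)^-1 * cutsum N s (bsum a Y k r) <= b) ->
  NY l r <= b.
Proof.
move=> lr Zb hb; apply: (N_le_cut hN) => // [t|s s0].
  have [c ct [c0|[i lir ci]]] := norm_bsum_coord hN a hY l r t; apply: (le_trans ct).
    by rewrite c0; apply: le_trans Zb; exact: N_ge0.
  by rewrite ci; apply: le_trans Zb; exact: (norm_coef_le hN a hZ).
pose k := minn (maxn (kappa (size s).+1) l) r.
have lkr : (l <= k <= r)%N by rewrite /k; lia.
have kgood i : (k <= i < r)%N -> (kappa (size s).+1 <= i)%N by rewrite /k; lia.
have := hb s k s0 lkr kgood.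
have f0 : 0 < f (size s).+1 by exact: schlumprecht_f_gt0.
rewrite -(ler_pM2l f0) mulrDr mulVKf ?gt_eqF// => {}hb.
rewrite (bsum_cat _ _ lkr); apply: le_trans (cutsumD hN _ _ _) _ => //.
apply: le_trans hb; rewrite lerD2r mulrA (mulrC (f _)).
have [lk|kl] := leqP l.+1 k; first by apply: bad_cutsum => //; rewrite /k in lk *; lia.
rewrite [bsum a Y l k]bsum_nil// cutsum0//; apply: mulr_ge0; last exact: N_ge0.
by rewrite mulr_ge0// ltW.
Qed.

Variables (C : R) (rmax : nat).
Hypotheses (AC : A <= C)
  (hC : forall l r, (l <= r <= rmax)%N -> NY l r <= C * NZ l r).

Let C0 : 0 <= C. Proof. by move: A2 AC; lra. Qed.

Lemma cutsum_le_split (b1 b2 b3 : R) (m1 m2 m3 : nat) :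
  2 <= b1 -> 0 <= b2 -> 0 <= b3 -> (0 < m1)%N -> (0 < m2)%N -> (0 < m3)%N ->
  (forall l r, (l <= r <= rmax)%N ->
    NY l r <= b1 * G m1 l r + b2 * G m2 l r + b3 * G m3 l r) ->
  forall s n k r, (0 < size s < n)%N -> (k <= r <= rmax)%N ->
    (forall i, (k <= i < r)%N -> (kappa n <= i)%N) ->
  cutsum N s (bsum a Y k r) <=
    b1 * G (3 * n * m1)%N k r + b2 * G (n * m2)%N k r + b3 * G (n * m3)%N k r.
Proof.
move=> b12 b20 b30 m10 m20 m30 h s n k r /andP[s0 sn] kr kg.
have n2 : (2 <= n)%N by lia.
apply: (le_trans (cutsum_bsum_le hN hY hZ b12 b20 b30 m10 m20 m30 h sn kr _)).
  by move=> i ir m mn; apply: good_Gam mn => //; exact: kg.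
have b10 : 0 <= b1 by lra.
have snm m : (0 < m)%N -> (0 < (size s).+1 * m <= n * m)%N.
  by move=> m0; rewrite muln_gt0 m0/= leq_mul.
have snm3 m : (0 < m)%N -> (0 < 3 * (size s).+1 * m <= 3 * n * m)%N.
  by move=> m0; rewrite -!mulnA muln_gt0/= leq_pmul2l// snm.
apply: lerD; [apply: lerD|]; apply: ler_wpM2l => //; apply: (Gam_mono hN) => //.
- exact: snm3.
- exact: snm.
- exact: snm.
Qed.

(** Restricted to sums without early vectors, because [N_bsum_le] removes the head before a node is
    estimated. *)
Definition tower_bound (b : R) (e : nat) := forall s n k r,
  (0 < size s < n)%N -> (2 ^ e <= n)%N -> (k <= r <= rmax)%N ->
  (forall i, (k <= i < r)%N -> (kappa n <= i)%N) ->
  cutsum N s (bsum a Y k r) <= b * f n * NZ k r.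


(* Expand [d] times the nodes of arity below [2^(2^l)]. The nodes of arity at
   least [2^(4^(l+1))] are covered by the hypothesis; at the remaining ones the
   crude constant [C] only occurs with a small factor. *)
Lemma expand_bound b l : A <= b -> tower_bound b (4 ^ l.+1) -> forall d k r,
  (k <= r <= rmax)%N ->
  NY k r <= b * G (2 ^ (d * (2 ^ l + 2)))%N k r +
    C * ((2 / 3) ^+ d + (2 ^+ l)^-1) * G (2 ^ (4 ^ l.+1 + 2 + d * 2 ^ l))%N k r.
Proof.
move=> Ab hb.
have b0 : 0 <= b by move: A2; lra.
have l2 : 0 < 2 ^+ l :> R by rewrite exprn_gt0.
have exp23 d : 0 < (2 / 3 : R) ^+ d by rewrite exprn_gt0// divr_gt0.
have w0 d : 0 <= C * ((2 / 3) ^+ d + (2 ^+ l)^-1).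
  by rewrite mulr_ge0// addr_ge0 ?ltW// invr_gt0.
have pow0 (e : nat) : (0 < 2 ^ e)%N by rewrite expn_gt0.
elim=> [|d IH] k r kr; have /andP[kr' rr] := kr.
  rewrite mul0n addn0 expn0 expr0; apply: (le_trans (hC kr)).
  apply: ler_wpDl; first by rewrite mulr_ge0// (Gam_ge0 hN).
  apply: ler_pM => //; [exact: N_ge0| |exact: N_le_Gam].
  by rewrite ler_peMr// lerDl invr_ge0 ltW.
apply: N_bsum_le => // [|s j s0 /andP[kj jr] sgood].
  apply: ler_wpDr; first by rewrite mulr_ge0// (Gam_ge0 hN).
  apply: (@le_trans _ _ (1 * G (2 ^ (d.+1 * (2 ^ l + 2)))%N k r)).
    by rewrite mul1r N_le_Gam.
  by apply: ler_wpM2r; [exact: Gam_ge0|move: A2; lra].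
set n := (size s).+1 in sgood *.
have n2 : (2 <= n)%N by rewrite /n ltnS.
have fn := schlumprecht_f_ge32 R n2.
have f0 : 0 < f n by lra.
have sn : (0 < size s < n)%N by rewrite s0 /n /=.
have jrr : (j <= r <= rmax)%N by rewrite jr.
have kjr : (k <= j <= r)%N by rewrite kj.
have Zk0 : 0 <= NZ k j by exact: N_ge0.
have Zj0 : 0 <= NZ j r by exact: N_ge0.
have KZ : K * NZ k j <= b * G 1 k j.
  by rewrite Gam1//; apply: ler_wpM2r => //; move: KA; lra.
have Gadd m (m' : nat) : (0 < m)%N -> (1 + m <= m')%N ->
    b * G 1 k j + b * G m j r <= b * G m' k r.
  move=> m0 mm'; rewrite -mulrDr; apply: ler_wpM2l => //.
  apply: le_trans (Gam_bsum_add hN a hZ kjr _ m0) _ => //.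
  by apply: Gam_mono => //; rewrite mm' andbT.
have pd : (2 <= 2 ^ (d.+1 * (2 ^ l + 2)))%N.
  by apply: (@leq_pexp2l 2 1) => //; rewrite muln_gt0 addn2.
have [large|small] := leqP (2 ^ (4 ^ l.+1)) n.
  have h := hb s n j r sn large jrr sgood.
  apply: ler_wpDr; first by rewrite mulr_ge0// (Gam_ge0 hN).
  apply: le_trans (Gadd 1%N _ isT pd); apply: lerD => //.
  by rewrite Gam1// ler_pdivrMl// mulrCA mulrA.
(* At a middle arity [C] is divided by [f n >= 2 ^ l]. At a small one the last term of the induction
   hypothesis is divided by [f n >= 3 / 2], which yields the next power of [2 / 3]. *)
have [mid|small'] := leqP (2 ^ (2 ^ l)) n.
  have C2 : 2 <= C by move: A2 AC; lra.
  have hC1 u v : (u <= v <= rmax)%N ->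
      NY u v <= C * G 1 u v + 0 * G 1 u v + 0 * G 1 u v.
    by move=> uv; rewrite !mul0r !addr0 Gam1//; exact: hC.
  have := cutsum_le_split C2 (lexx 0) (lexx 0) (ltn0Sn 0) (ltn0Sn 0) (ltn0Sn 0)
    hC1 sn jrr sgood.
  rewrite !mul0r !addr0 muln1 => h.
  apply: lerD.
    apply: (le_trans KZ); apply: le_trans (Gadd 1%N _ isT pd).
    by rewrite lerDl mulr_ge0// (Gam_ge0 hN).
  rewrite ler_pdivrMl//; apply: (le_trans h).
  rewrite mulrCA -mulrA ler_wpM2l// mulrA.
  have n30 : (0 < 3 * n)%N by rewrite muln_gt0.
  apply: (@le_trans _ _ (1 * G (3 * n)%N k r)).
    by rewrite mul1r; apply: (Gam_bsum_suffix hN a hZ).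
  apply: ler_pM => //; first exact: Gam_ge0.
    have fl : 2 ^+ l <= f n by rewrite -natrX; exact: schlumprecht_f_ge.
    rewrite mulrDl; apply: ler_wpDl; first by rewrite mulr_ge0 ?ltW.
    by rewrite mulrC ler_pdivlMr// mul1r.
  apply: (Gam_mono hN) => //; rewrite n30 /=.
  apply: (@leq_trans (2 ^ 2 * 2 ^ (4 ^ l.+1))).
    by apply: leq_mul => //; exact: ltnW.
  by rewrite -expnD leq_exp2l// [leqLHS]addnC leq_addr.
have b2 : 2 <= b by move: A2; lra.
have hIH u v : (u <= v <= rmax)%N -> NY u v <=
    b * G (2 ^ (d * (2 ^ l + 2)))%N u v +
    C * ((2 / 3) ^+ d + (2 ^+ l)^-1) * G (2 ^ (4 ^ l.+1 + 2 + d * 2 ^ l))%N u v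
    + 0 * G 1 u v.
  by move=> uv; rewrite mul0r addr0; exact: IH.
have := cutsum_le_split b2 (w0 d) (lexx 0) (pow0 _) (pow0 _) (ltn0Sn 0) hIH sn jrr sgood.
rewrite mul0r addr0; set m1 := (3 * n * _)%N; set m2 := (n * _)%N => h.
have m10 : (0 < m1)%N by rewrite /m1 !muln_gt0 pow0.
have m20 : (0 < m2)%N by rewrite /m2 !muln_gt0 pow0.
have h1 : (1 + m1 <= 2 ^ (d.+1 * (2 ^ l + 2)))%N.
  rewrite mulSn expnD expnD /m1.
  have := pow0 (d * (2 ^ l + 2))%N; move: (2 ^ (d * _))%N => u.
  exact: small_arity_count small'.
have h2 : (m2 <= 2 ^ (4 ^ l.+1 + 2 + d.+1 * 2 ^ l))%N.
  rewrite mulSn addnCA expnD /m2; apply: leq_mul => //; exact: ltnW.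
apply: (@le_trans _ _ (b * G 1 k j + (b * G m1 j r +
    (f n)^-1 * (C * ((2 / 3) ^+ d + (2 ^+ l)^-1)) * G m2 j r))).
  apply: lerD => //; rewrite ler_pdivrMl// mulrDr !mulrA mulfV ?gt_eqF// mul1r.
  apply: (le_trans h); rewrite lerD2r -mulrA ler_peMl//.
    by rewrite mulr_ge0// (Gam_ge0 hN).
  by lra.
rewrite addrA; apply: lerD; first exact: Gadd.
apply: (@le_trans _ _ ((f n)^-1 * (C * ((2 / 3) ^+ d + (2 ^+ l)^-1)) * G m2 k r)).
  apply: ler_wpM2l; first by rewrite mulr_ge0// invr_ge0 ltW.
  exact: (Gam_bsum_suffix hN a hZ).
apply: ler_pM => //.
- by rewrite mulr_ge0// invr_ge0 ltW.
- exact: Gam_ge0.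
- rewrite mulrCA ler_wpM2l// mulrDr exprS; apply: lerD.
    apply: ler_wpM2r; first exact: ltW.
    by rewrite -[leRHS]invf_div lef_pV2 ?posrE// divr_gt0.
  by rewrite ler_piMl ?invr_ge0 ?(ltW l2)// invf_le1//; lra.
- by apply: (Gam_mono hN) => //; rewrite m20.
Qed.


(* Chosen so that [sig l - sig l.+1] absorbs the loss of [tower_step]. *)
Definition sig (l : nat) : R := 8 * (l%:R + 8) / 2 ^+ l.

Lemma sig_ge0 l : 0 <= sig l.
Proof. by rewrite /sig divr_ge0 ?exprn_ge0// mulr_ge0// addr_ge0. Qed.

(** The node has [log2 n >= 4 ^ l], while expanding the levels below it multiplies its pieces by
    [3 * 2 ^ P] with [P] of order [l * 2 ^ l]. Under the logarithm [f] this is a relative loss of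
    order [l / 2 ^ l], the order of [sig l]. *)
Lemma tower_step l : 10 <= l%:R :> R -> 32 * (l%:R + 8) <= 2 ^+ l :> R ->
  tower_bound (A + C * sig l.+1) (4 ^ l.+1) -> tower_bound (A + C * sig l) (4 ^ l).
Proof.
move=> l10 hl hD s n k r sn hn kr kg.
have Cs0 : 0 <= C * sig l.+1 by rewrite mulr_ge0// sig_ge0.
have Ab : A <= A + C * sig l.+1 by lra.
(* Depth [2 * l] because [(2 / 3) ^ 2 <= 1 / 2]: the weight of [C] falls to [2 / 2 ^ l]. *)
have := expand_bound Ab hD (2 * l); set b := A + C * sig l.+1 in Ab *.
set P := (2 * l * (2 ^ l + 2))%N; set Q := (4 ^ l.+1 + 2 + 2 * l * 2 ^ l)%N.
set w := C * _ => hE.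
have pow0 (e : nat) : (0 < 2 ^ e)%N by rewrite expn_gt0.
have b2 : 2 <= b by move: A2; lra.
have T0 : 0 < 2 ^+ l :> R by rewrite exprn_gt0.
have w0 : 0 <= w.
  by rewrite mulr_ge0// addr_ge0 ?invr_ge0 ?exprn_ge0// ?divr_ge0// ltW.
have hE' u v : (u <= v <= rmax)%N -> NY u v <=
    b * G (2 ^ P)%N u v + w * G (2 ^ Q)%N u v + 0 * G 1 u v.
  by move=> uv; rewrite mul0r addr0; exact: hE.
have := cutsum_le_split b2 w0 (lexx 0) (pow0 _) (pow0 _) (ltn0Sn 0) hE' sn kr kg.
rewrite mul0r addr0 => h; apply: (le_trans h).
have n0 : (0 < n)%N by case/andP: sn => _; exact: leq_ltn_trans.
have /andP[] := trunc_log_bounds (ltnSn 1) n0; set e := trunc_log 2 n => en ne.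
have le_e : (4 ^ l <= e)%N by apply: trunc_log_max.
have h1 : f (3 * n * 2 ^ P) <= (e + 3 + P)%:R.
  by apply: schlumprecht_f_le; rewrite expnD ltn_pmul2r// triple_arity_lt.
have h2 : f (n * 2 ^ Q) <= (e + 1 + Q)%:R.
  by apply: schlumprecht_f_le; rewrite expnD ltn_pmul2r// addn1.
have h3 : e%:R <= f n by exact: schlumprecht_f_ge.
have g1 : G (3 * n * 2 ^ P)%N k r <= (e + 3 + P)%:R * NZ k r.
  apply: le_trans (Gam_bound hN _ _) _ => //; first by rewrite !muln_gt0 n0 pow0.
  by apply: ler_wpM2r => //; exact: N_ge0.
have g2 : G (n * 2 ^ Q)%N k r <= (e + 1 + Q)%:R * NZ k r.
  apply: le_trans (Gam_bound hN _ _) _ => //; first by rewrite !muln_gt0 n0 pow0.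
  by apply: ler_wpM2r => //; exact: N_ge0.
have b0 : 0 <= b by lra.
have Z0 : 0 <= NZ k r by exact: N_ge0.
apply: (@le_trans _ _ ((b * (e + 3 + P)%:R + w * (e + 1 + Q)%:R) * NZ k r)).
  by rewrite [leRHS]mulrDl; apply: lerD; rewrite -[leRHS]mulrA ler_wpM2l.
apply: ler_wpM2r => //.
apply: (@le_trans _ _ ((A + C * sig l) * e%:R)); last first.
  by apply: ler_wpM2l => //; rewrite addr_ge0 ?mulr_ge0 ?sig_ge0//; move: A2; lra.
have Te : (2 ^+ l) ^+ 2 <= e%:R :> R.
  by rewrite -!natrX ler_nat -expnM mulnC expnM.
have T1 : 1024 <= 2 ^+ l :> R.
  have : 2 ^+ 10 <= 2 ^+ l :> R.
    by apply: ler_weXn2l; [lra|rewrite -(ler_nat R)].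
  by apply: le_trans; rewrite -natrX ler_nat.
have w_le : w <= C * (2 / 2 ^+ l).
  apply: ler_wpM2l => //; rewrite [leRHS]mulr_natl mulr2n lerD2r exprM -exprVn.
  have le12 : (2 / 3) ^+ 2 <= 2^-1 :> R by rewrite expr2; lra.
  by apply: lerXn2r; rewrite ?nnegrE ?invr_ge0 ?exprn_ge0 ?divr_ge0.
apply: le_trans _ (level_arith T1 (ler0n R l) hl Te C0 AC).
rewrite /b /sig /P /Q -(natr1 l) exprS !natrD !natrM !natrD !natrX.
apply: lerD; first by rewrite le_eqVlt; apply/orP; left; apply/eqP; ring.
apply: (@le_trans _ _ (C * (2 / 2 ^+ l) * (e%:R + 1 + (4 ^+ l.+1 + 2 + 2 * l%:R * 2 ^+ l)))).
  by apply: ler_wpM2r => //; rewrite !addr_ge0 ?mulr_ge0 ?exprn_ge0.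
rewrite exprS (_ : 4 ^+ l = (2 ^+ l) ^+ 2 :> R)// -exprM mulnC exprM.
by congr (_ ^+ _); rewrite expr2; ring.
Qed.

(** Start of the descent: the finitely many vectors below [rmax] have a bounded total [t] of pieces,
    however they are cut, and at a high enough level [f n] exceeds [t]. *)
Lemma tower_base l0 : exists2 l, (l0 <= l)%N & tower_bound (A + C * sig l) (4 ^ l).
Proof.
have [cYi _ _ _] := hY.
have /choice[B hB] : forall i, exists B, forall s, cutsum N s (Y i) <= B.
  by move=> i; exact: cutsum_bounded.
have B0 i : 0 <= B i by apply: le_trans (hB i [::]); exact: N_ge0.
pose t := \sum_(0 <= i < rmax) B i.
have t0 : 0 <= t by apply: sumr_ge0 => i _.
exists (maxn l0 (Num.bound t)) => [|s n k r /andP[s0 sn] ln /andP[kr rr] _].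
  by rewrite leq_maxl.
set l := maxn _ _ in ln *.
have tl : t <= l%:R.
  by apply: ltW; apply: (lt_le_trans (archi_boundP t0)); rewrite ler_nat leq_maxr.
have Z0 : 0 <= NZ k r by exact: N_ge0.
have lf : l%:R <= f n.
  apply: le_trans (schlumprecht_f_ge R ln); rewrite ler_nat.
  by apply: ltnW; apply: ltn_expl.
apply: (le_trans (cutsum_sum hN _ _ _)); first by move=> i; exact: c00Z.
apply: (@le_trans _ _ (\sum_(k <= i < r) NZ k r * B i)).
  rewrite big_nat [leRHS]big_nat; apply: ler_sum => i kir.
  rewrite (cutsumZ hN)//; apply: ler_pM => //; first exact: cutsum_ge0.
  exact: (norm_coef_le hN a hZ).
rewrite -mulr_sumr mulrC; apply: ler_wpM2r => //.
apply: (@le_trans _ _ t).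
  have -> : t = \sum_(0 <= i < k) B i +
      (\sum_(k <= i < r) B i + \sum_(r <= i < rmax) B i).
    by rewrite -big_cat_nat// -big_cat_nat// (leq_trans kr).
  have S0 u v : 0 <= \sum_(u <= i < v) B i by apply: sumr_ge0.
  by have := S0 0%N k; have := S0 r rmax; lra.
apply: (le_trans tl); apply: (le_trans lf); rewrite ler_peMl//.
  by rewrite (le_trans _ lf).
by rewrite ler_wpDr ?mulr_ge0 ?sig_ge0//; move: A2; lra.
Qed.

Variable l0 : nat.
Hypotheses (l010 : 10 <= l0%:R :> R)
  (l0P : forall l, (l0 <= l)%N -> 32 * (l%:R + 8) <= 2 ^+ l :> R).

(** The condition on [l0] says that [sig l0 <= 1 / 4], and the losses of all levels above have been
    absorbed into [sig l0]. *)
Lemma tower_bottom : tower_bound (A + C / 4) (4 ^ l0).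
Proof.
have [L l0L hL] := tower_base l0.
have hj j : (j <= L - l0)%N -> tower_bound (A + C * sig (L - j)) (4 ^ (L - j)).
  elim: j => [|j IH] jL; first by rewrite subn0.
  have E : ((L - j.+1).+1 = L - j)%N by lia.
  apply: tower_step; rewrite ?E; last by apply: IH; lia.
  - by apply: (le_trans l010); rewrite ler_nat; lia.
  - by apply: l0P; lia.
have := hj (L - l0)%N (leqnn _); rewrite subKn// => h s n k r sn ln kr kg.
apply: (le_trans (h s n k r sn ln kr kg)).
rewrite -[leLHS]mulrA -[leRHS]mulrA; apply: ler_wpM2r.
  apply: mulr_ge0; last exact: N_ge0.
  by apply: ltW; apply: schlumprecht_f_gt0; case/andP: sn => _; exact: leq_ltn_trans.
rewrite lerD2l; apply: ler_wpM2l => //.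
have T0 : 0 < 2 ^+ l0 :> R by rewrite exprn_gt0.
by rewrite /sig ler_pdivrMr//; have := l0P (leqnn l0); lra.
Qed.

(** The remaining small arities are expanded [d] times. A level adds [A] for the early head and [6]
    for the split vectors, and does not multiply: the large constant stands before the norm itself,
    whose [n] pieces cost at most the [f n] by which the node divides. *)
Lemma root_bound d k r : (k <= r <= rmax)%N ->
  NY k r <= (d%:R * (A + 6) + 2 * A + C / 4) * NZ k r +
    C * (2 / 3) ^+ d * G (2 ^ (d * 4 ^ l0))%N k r.
Proof.
have pow0 (e : nat) : (0 < 2 ^ e)%N by rewrite expn_gt0.
have exp23 m : 0 <= (2 / 3 : R) ^+ m by rewrite exprn_ge0// divr_ge0.
have w0 m : 0 <= C * (2 / 3) ^+ m by rewrite mulr_ge0.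
have A0 : 0 <= A by move: A2; lra.
have U0 m : 0 <= m%:R * (A + 6) + 2 * A + C / 4.
  by rewrite !addr_ge0 ?mulr_ge0 ?addr_ge0.
elim: d k r => [|d IH] k r kr; have /andP[kr' rr] := kr.
  rewrite mul0n expn0 expr0 mulr1 Gam1//; apply: (le_trans (hC kr)).
  by apply: ler_wpDl => //; apply: mulr_ge0; [exact: (U0 0%N)|exact: N_ge0].
have Zkr0 : 0 <= NZ k r by exact: N_ge0.
apply: N_bsum_le => // [|s j s0 /andP[kj jr] sgood].
  apply: ler_wpDr; first by rewrite mulr_ge0// (Gam_ge0 hN).
  rewrite ler_peMl//.
  have : 0 <= d.+1%:R * (A + 6) by rewrite mulr_ge0 ?addr_ge0.
  by move: A2 C0; lra.
set n := (size s).+1 in sgood *.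
have n2 : (2 <= n)%N by rewrite /n ltnS.
have fn := schlumprecht_f_ge32 R n2.
have f0 : 0 < f n by lra.
have sn : (0 < size s < n)%N by rewrite s0 /n /=.
have jrr : (j <= r <= rmax)%N by rewrite jr.
have kjr : (k <= j <= r)%N by rewrite kj.
have Zjr : NZ j r <= NZ k r by apply: (N_bsum_sub hN a hZ); rewrite ?kj.
have KZ : K * NZ k j <= A * NZ k r.
  apply: ler_pM => //; first exact: N_ge0.
  by apply: (N_bsum_sub hN a hZ); rewrite ?leqnn ?kj.
have [large|small] := leqP (2 ^ (4 ^ l0)) n.
  apply: ler_wpDr; first by rewrite mulr_ge0// (Gam_ge0 hN).
  have h := tower_bottom sn large jrr sgood.
  have : (f n)^-1 * cutsum N s (bsum a Y j r) <= (A + C / 4) * NZ k r.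
    rewrite ler_pdivrMl//; apply: (le_trans h); rewrite [leRHS]mulrCA [leRHS]mulrA.
    by apply: ler_wpM2l => //; rewrite mulr_ge0 ?(ltW f0)// addr_ge0// divr_ge0.
  have : 0 <= d.+1%:R * (A + 6) * NZ k r by rewrite !mulr_ge0 ?addr_ge0.
  by move: KZ; lra.
set U := d%:R * (A + 6) + 2 * A + C / 4 in IH *.
have UZ0 : 0 <= U by exact: U0.
(* The added term [2 * G 1] takes the place of [b1], so that the tripling of pieces falls on it and
   spares [U]. With [f (3 * n) <= 3 * f n] it contributes [6 = 2 * 3]. *)
have hIH u v : (u <= v <= rmax)%N -> NY u v <=
    2 * G 1 u v + U * G 1 u v + C * (2 / 3) ^+ d * G (2 ^ (d * 4 ^ l0))%N u v.
  move=> uv; apply: (le_trans (IH u v uv)); rewrite lerD2r Gam1//.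
  by rewrite lerDr mulr_ge0 ?(N_ge0 hN).
have := cutsum_le_split (lexx 2) UZ0 (w0 d) (ltn0Sn 0) (ltn0Sn 0) (pow0 _) hIH
  sn jrr sgood.
rewrite !muln1 => h.
have e1 : G (3 * n)%N j r <= 3 * f n * NZ k r.
  apply: (le_trans (Gam_bound hN _ _)) => //.
  apply: ler_pM => //; [by rewrite ltW// schlumprecht_f_gt0// ?muln_gt0|exact: N_ge0|].
  have /andP[] := trunc_log_bounds (ltnSn 1) (ltnW n2).
  set e := trunc_log 2 n => en ne.
  have := schlumprecht_f_le R (triple_arity_lt ne).
  have := schlumprecht_f_ge R en; rewrite natrD; lra.
have e2 : G n j r <= f n * NZ k r.
  apply: (le_trans (Gam_bound hN _ _)) => //.
  by apply: ler_wpM2l => //; exact: ltW.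
have e3 : G (n * 2 ^ (d * 4 ^ l0))%N j r <= G (2 ^ (d.+1 * 4 ^ l0))%N k r.
  have npos : (0 < n * 2 ^ (d * 4 ^ l0))%N by rewrite muln_gt0 pow0 andbT.
  apply: le_trans (Gam_bsum_suffix hN a hZ kjr npos) _.
  apply: Gam_mono => //; rewrite npos /= mulSn expnD leq_mul//; exact: ltnW.
have E : (f n)^-1 * cutsum N s (bsum a Y j r) <= 6 * NZ k r + U * NZ k r +
    C * (2 / 3) ^+ d.+1 * G (2 ^ (d.+1 * 4 ^ l0))%N k r.
  rewrite ler_pdivrMl//; apply: (le_trans h).
  rewrite !mulrDr; apply: lerD; [apply: lerD|].
  - apply: (le_trans (ler_wpM2l _ e1)) => //.
    by rewrite le_eqVlt; apply/orP; left; apply/eqP; ring.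
  - by rewrite mulrCA; exact: ler_wpM2l.
  apply: (le_trans (ler_wpM2l (w0 d) e3)); rewrite mulrA.
  apply: ler_wpM2r; first exact: Gam_ge0.
  have -> : f n * (C * (2 / 3) ^+ d.+1) = C * (2 / 3) ^+ d * (f n * (2 / 3)).
    by rewrite exprS; ring.
  by rewrite ler_peMr//; lra.
rewrite -(natr1 d); rewrite /U in E; move: E KZ; lra.
Qed.

End FixedCoefficients.
End Recursion.

Lemma exists_initial_level (R : realType) : exists l0 : nat,
  10 <= l0%:R :> R /\
  forall l, (l0 <= l)%N -> 32 * (l%:R + 8) <= 2 ^+ l :> R.
Proof.
exists 10%N; split => // l; elim: l => // l IH.
rewrite leq_eqVlt => /predU1P[<-|/IH {}IH].
  by rewrite -natrX -natrD -natrM ler_nat.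
by have := ler0n R l; rewrite exprS -natr1; lra.
Qed.

(** For [E = 4 ^ l0] the factor [(d * E)%:R + 1] bounds [f (2 ^ (d * E))], the price of the last
    term of [root_bound]. *)
Lemma exists_small_depth (R : realType) (E : nat) :
  exists d : nat, (2 / 3) ^+ d * ((d * E)%:R + 1) <= 1 / 4 :> R.
Proof.
(* Four levels gain a factor 4, and [4 ^ i >= (i + 1) ^ 2]; this [i] makes the square exceed
   [4 * (4 * i * E + 1)]. *)
pose i := (16 * E + 4)%N; exists (4 * i)%N.
have q : (2 / 3) ^+ 4 <= 4^-1 :> R.
  have -> : (2 / 3 : R) ^+ 4 = (2 / 3 * (2 / 3)) * (2 / 3 * (2 / 3)) by ring.
  by lra.
have h1 : (2 / 3 : R) ^+ (4 * i) <= (4 ^+ i)^-1.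
  by rewrite exprM -exprVn; apply: lerXn2r; rewrite ?nnegrE ?invr_ge0.
have h2 : (i.+1%:R) ^+ 2 <= 4 ^+ i :> R.
  rewrite -!natrX ler_nat (_ : (4 = 2 ^ 2)%N)// -expnM mulnC expnM leq_exp2r//.
  exact: ltn_expl.
have i0 : 0 < i.+1%:R ^+ 2 :> R by rewrite exprn_gt0.
have h3 : (4 * i * E)%:R + 1 <= i.+1%:R ^+ 2 / 4 :> R.
  rewrite ler_pdivlMr// -natrX natr1 -natrM ler_nat /i; nia.
apply: (@le_trans _ _ ((i.+1%:R ^+ 2)^-1 * (i.+1%:R ^+ 2 / 4))).
  apply: ler_pM => //.
  apply: (le_trans h1); rewrite lef_pV2 ?posrE//.
by rewrite mulKf ?gt_eqF// div1r.
Qed.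

(** * Bootstrapping the domination constant *)

Section Domination.
Variables (R : realType) (N : (nat -> R) -> R).
Hypothesis hN : is_schlumprecht_norm N.
Local Notation f := (schlumprecht_f R).
Variables (p q : nat -> nat) (Y Z : nat -> nat -> R).
Hypotheses (hY : blocks N p Y) (hZ : blocks N q Z).
Variables (K : R) (kappa : nat -> nat).
Hypothesis K0 : 0 <= K.
Hypothesis good_Gam : forall n i m, (2 <= n)%N -> (kappa n <= i)%N ->
  (0 < m <= n)%N -> Gam N m (Y i) <= 2 * Gam N m (Z i).
Hypothesis bad_cutsum : forall a s l k, (0 < size s)%N ->
  (l <= k <= kappa (size s).+1)%N ->
  cutsum N s (bsum a Y l k) <= K * f (size s).+1 * N (bsum a Z l k).

Lemma block_domination :
  exists D, forall a r, N (bsum a Y 0 r) <= D * N (bsum a Z 0 r).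
Proof.
pose A := 2 + K.
have A2 : 2 <= A by rewrite /A; move: K0; lra.
have KA : K <= A by rewrite /A; lra.
have A0 : 0 <= A by lra.
have [l0 [l010 l0P]] := exists_initial_level R.
have [d hd] := exists_small_depth R (4 ^ l0).
pose B := d%:R * (A + 6) + 2 * A.
have dA : 0 <= d%:R * (A + 6) by rewrite mulr_ge0 ?addr_ge0.
have AB : A <= B by rewrite /B; lra.
exists (2 * B) => a r.
have cY l k := c00_bsum a hY l k.
have cZ l k := c00_bsum a hZ l k.
(* One [C / 4] comes from the nodes of large arity, the other from the last term of [root_bound], by
   the choice of [d]. *)
have improve C : A <= C ->
    (forall l k, (l <= k <= r)%N -> N (bsum a Y l k) <= C * N (bsum a Z l k)) ->
    forall l k, (l <= k <= r)%N ->
      N (bsum a Y l k) <= (B + C / 2) * N (bsum a Z l k).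
  move=> AC hC l k lk.
  have := root_bound hN hY hZ good_Gam bad_cutsum A2 K0 KA AC hC l010 l0P d lk.
  move/le_trans; apply.
  have Z0 : 0 <= N (bsum a Z l k) by exact: N_ge0.
  have C0 : 0 <= C by lra.
  have g : Gam N (2 ^ (d * 4 ^ l0)) (bsum a Z l k) <=
      ((d * 4 ^ l0)%:R + 1) * N (bsum a Z l k).
    apply: le_trans (Gam_bound hN _ _) _ => //; first by rewrite expn_gt0.
    by apply: ler_wpM2r => //; rewrite natr1 schlumprecht_f_exp2_le.
  have w0 : 0 <= C * (2 / 3) ^+ d by rewrite mulr_ge0// exprn_ge0// divr_ge0.
  have := ler_wpM2l w0 g.
  have := ler_wpM2l (mulr_ge0 C0 Z0) hd.
  rewrite -/B; set x := (2 / 3) ^+ d; set y := (_ + 1); set z := N _.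
  set u := Gam _ _ _ => h1 h2.
  have -> : (B + C / 2) * z = (B + C / 4) * z + C * z * (1 / 4) by field.
  rewrite lerD2l; apply: (le_trans h2); apply: le_trans h1.
  by rewrite le_eqVlt; apply/orP; left; apply/eqP; ring.
(* The first constant is crude: at most [r] normalized terms, each coefficient bounded by the norm
   of the sum. *)
have start l k : (l <= k <= r)%N ->
    N (bsum a Y l k) <= (A + r%:R) * N (bsum a Z l k).
  move=> /andP[lk kr]; have Z0 : 0 <= N (bsum a Z l k) by exact: N_ge0.
  have [cYi NYi _ _] := hY.
  apply: (le_trans (N_sum hN _ _)); first by move=> i _; exact: c00Z.
  apply: (@le_trans _ _ (\sum_(l <= i < k) N (bsum a Z l k))).
    rewrite big_nat [leRHS]big_nat; apply: ler_sum => i lik.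
    by rewrite (N_homog hN)// NYi mulr1; exact: (norm_coef_le hN a hZ).
  rewrite sumr_const_nat -[leLHS]mulr_natl ler_wpM2r//.
  apply: ler_wpDl => //; rewrite ler_nat; lia.
have iter t : forall l k, (l <= k <= r)%N ->
    N (bsum a Y l k) <= (2 * B + (A + r%:R) / 2 ^+ t) * N (bsum a Z l k).
  elim: t => [|t IH] l k lk.
    apply: (le_trans (start _ _ lk)); rewrite expr0 divr1.
    apply: ler_wpM2r; first exact: N_ge0.
    by lra.
  have p2 : 0 < 2 ^+ t :> R by rewrite exprn_gt0.
  have w0 : 0 <= (A + r%:R) / 2 ^+ t by rewrite divr_ge0 ?addr_ge0// ltW.
  have := improve _ _ IH l k lk.
  rewrite (_ : B + _ / 2 = 2 * B + (A + r%:R) / 2 ^+ t.+1).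
    by apply; lra.
  by rewrite exprS; field; rewrite gt_eqF.
apply/ler_addgt0Pr => e e0.
set z := N (bsum a Z 0 r); have Z0 : 0 <= z by exact: N_ge0.
pose v := (A + r%:R) * z / e.
have v0 : 0 <= v by rewrite divr_ge0 ?mulr_ge0 ?addr_ge0// ltW.
pose t := Num.bound v.
apply: (le_trans (iter t _ _ _)); first by rewrite leq0n leqnn.
rewrite -/z mulrDl lerD2l.
have p2 : 0 < 2 ^+ t :> R by rewrite exprn_gt0.
rewrite mulrAC ler_pdivrMr// -ler_pdivrMl// [leLHS]mulrC -/v.
apply: ltW; apply: (lt_le_trans (archi_boundP v0)).
by rewrite -natrX ler_nat -/t ltnW// ltn_expl.
Qed.

End Domination.

(** * Choice of the subsequence *)

Lemma filter_forall_le (T : Type) (F : set_system T) (P : nat -> set T) :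
  Filter F -> (forall m, F (P m)) ->
  forall M, F [set h | forall m, (m <= M)%N -> P m h].
Proof.
move=> FF FP; elim=> [|M IH].
  by apply: filterS (FP 0%N) => h hm m; rewrite leqn0 => /eqP ->.
apply: filterS (filterI IH (FP M.+1)) => h [h1 h2] m.
by rewrite leq_eqVlt => /predU1P[->//|]; exact: h1.
Qed.

(** By Tychonoff the sequences have a cluster point in the product of the segments [[0, c m]]; it
    takes the place of a diagonal subsequence. *)
Lemma bounded_sequences_cluster (R : realType) (u : nat -> nat -> R) (c : nat -> R) :
  (forall i m, 0 <= u i m <= c m) ->
  exists g : nat -> R, forall M i0,
    exists2 i, (i0 <= i)%N & forall m, (m <= M)%N -> `|u i m - g m| <= 1 / 2.
Proof.
move=> uc.
have tych := @tychonoff nat (fun=> R) (fun m => `[0, c m]%classic)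
  (fun m => @segment_compact R 0 (c m)).
have FA : (u @ \oo) [set h | forall m, `[0, c m]%classic (h m)].
  by exists 0%N => // i _ m /=; rewrite in_itv /= uc.
have [g [_ gu]] := tych (u @ \oo) _ FA.
exists g => M i0.
have one m : nbhs (g : prod_topology (fun=> R)) [set h | `|h m - g m| <= 1 / 2].
  have nbm : nbhs (proj m (g : prod_topology (fun=> R)) : R)
      [set y : R | `|y - g m| <= 1 / 2].
    apply/nbhs_ballP; exists (1 / 2) => /=; first by rewrite divr_gt0.
    by move=> y; rewrite /ball /= distrC => /ltW.
  exact: (@proj_continuous nat (fun=> R) m g _ nbm).
have nb := filter_forall_le (nbhs_filter (g : prod_topology (fun=> R))) one M.
have Fi0 : (u @ \oo) [set u i | i in [set i | (i0 <= i)%N]].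
  by exists i0 => // i /= ii0; exists i.
have [h [[i ii0 <-] hi]] := gu _ _ Fi0 nb.
by exists i.
Qed.

Section Selection.
Variables (R : realType) (N : (nat -> R) -> R).
Hypothesis hN : is_schlumprecht_norm N.
Local Notation f := (schlumprecht_f R).
Variable b : nat -> nat -> R.
Hypotheses (cb : forall i, c00 (b i)) (Nb : forall i, N (b i) = 1).

Lemma Gam_le_f i m : (0 < m)%N -> Gam N m (b i) <= f m.
Proof. by move=> m0; have := Gam_bound hN (cb i) m0; rewrite Nb mulr1. Qed.

Lemma Gam_ge1 i m : (0 < m)%N -> 1 <= Gam N m (b i).
Proof. by move=> m0; rewrite -(Nb i); exact: N_le_Gam. Qed.

Lemma Gam_profile : exists g : nat -> R, forall M i0,
  exists2 i, (i0 <= i)%N &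
    forall m, (0 < m <= M)%N -> `|Gam N m (b i) - g m| <= 1 / 2.
Proof.
have [|g hg] := @bounded_sequences_cluster R (fun i m => Gam N m.+1 (b i)) (fun m => f m.+1).
  by move=> i m; rewrite Gam_le_f// andbT (le_trans _ (Gam_ge1 i _)).
exists (fun m => g m.-1) => M i0; have [i ii0 hi] := hg M i0.
by exists i => // -[//|m] /andP[_ /ltnW mM]; exact: hi.
Qed.

Lemma f_large (v : R) : exists M, forall n, (M <= n)%N -> v <= f n.
Proof.
exists (2 ^ Num.bound `|v|)%N => n /(schlumprecht_f_ge R); apply: le_trans.
by apply: le_trans (ler_norm v) _; apply: ltW; exact: archi_boundP.
Qed.

Lemma exists_bound : exists B : nat -> R, forall i s, cutsum N s (b i) <= B i.
Proof.
have /choice[B hB] : forall i, exists B, forall s, cutsum N s (b i) <= B.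
  by move=> i; exact: cutsum_bounded.
by exists B.
Qed.

(** The order of choice is [psi j] for [j < k], then [Nk k], then [psi k]: the threshold must beat
    the bounds [B] of the vectors already chosen, and the next vector must follow [g] up to the
    threshold. [Q] stays open because the two cases for [g] ask different things of the
    thresholds. *)
Lemma exists_subsequence (Q : nat -> nat -> Prop) (g B : nat -> R) :
  (forall k, exists M, forall n, (M <= n)%N -> Q k n) ->
  (forall M i0, exists2 i, (i0 <= i)%N &
    forall m, (0 < m <= M)%N -> `|Gam N m (b i) - g m| <= 1 / 2) ->
  exists (Nk psi : nat -> nat),
    [/\ {homo Nk : i j / (i < j)%N}, {homo psi : i j / (i < j)%N},
        forall k, Q k (Nk k),
        forall k j, (j < k)%N -> k.+1%:R * B (psi j) <= f (Nk k)
      & forall k m, (0 < m <= Nk k)%N -> `|Gam N m (b (psi k)) - g m| <= 1 / 2].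
Proof.
move=> hQ hg.
pose ok (k : nat) (z : nat * nat) := Q k z.1 /\
  forall m, (0 < m <= z.1)%N -> `|Gam N m (b z.2) - g m| <= 1 / 2.
(* The state carries its own index, since the conditions on the next pair depend on it. *)
pose next (z z' : nat * (nat * nat)) :=
  [/\ z'.1 = z.1.+1, (z.2.1 < z'.2.1)%N, (z.2.2 < z'.2.2)%N, ok z'.1 z'.2
    & forall i, (i <= z.2.2)%N -> z'.1.+1%:R * B i <= f z'.2.1].
have exnext z : {z' | next z z'}.
  apply: cid; case: z => k [M i].
  have [M1 hM1] := hQ k.+1.
  have [M2 hM2] : exists M2, forall n, (M2 <= n)%N ->
      forall j, (j <= i)%N -> k.+2%:R * B j <= f n.
    elim: i => [|i [M2 hM2]].
      have [M2 hM2] := f_large (k.+2%:R * B 0%N).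
      by exists M2 => n /hM2 h j; rewrite leqn0 => /eqP ->.
    have [M3 hM3] := f_large (k.+2%:R * B i.+1).
    exists (maxn M2 M3) => n; rewrite geq_max => /andP[/hM2 h2 /hM3 h3] j.
    by rewrite leq_eqVlt => /predU1P[->//|]; exact: h2.
  pose M' := maxn M.+1 (maxn M1 M2).
  have [i' ii' hi'] := hg M' i.+1.
  exists (k.+1, (M', i')); split => //=.
  - by rewrite /M' leq_maxl.
  - split => //=; apply: hM1; rewrite /M'; lia.
  - by apply: hM2; rewrite /M'; lia.
have [M0 hM0] := hQ 0%N.
have [i0 _ hi0] := hg M0 0%N.
have [z [z0 zn]] := dependent_choice exnext (0%N, (M0, i0)).
have z1 k : (z k).1 = k.
  by elim: k => [|k IH]; [rewrite z0|have [-> _ _ _ _] := zn k; rewrite IH].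
have zok k : ok k (z k).2.
  case: k => [|k]; first by rewrite z0; split => //=; exact: hM0.
  by have [_ _ _] := zn k; rewrite z1.
have homoS (h : nat -> nat) : (forall k, (h k < h k.+1)%N) -> {homo h : i j / (i < j)%N}.
  by move=> hS; apply: homo_ltn => // ? ? ?; exact: ltn_trans.
have psi_mono : {homo (fun k => (z k).2.2) : i j / (i < j)%N}.
  by apply: homoS => k; have [] := zn k.
exists (fun k => (z k).2.1), (fun k => (z k).2.2); split => //.
- by apply: homoS => k; have [] := zn k.
- by move=> k; have [] := zok k.
- case=> // k j; rewrite ltnS => jk; have [_ _ _ _] := zn k; rewrite z1; apply.
  by move: jk; rewrite leq_eqVlt => /predU1P[->//|/psi_mono/ltnW].
- by move=> k; have [] := zok k.
Qed.

End Selection.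

Lemma double_lt_uphalf i k : (i < uphalf k)%N -> (i.*2.+1 <= k)%N.
Proof. lia. Qed.

Lemma late_range_le k l k0 h m : (k <= k0.+1)%N -> (k0 <= h.*2)%N ->
  (h.*2.+1 <= m)%N -> (k - l <= m)%N.
Proof. lia. Qed.

(** * The cost of early vectors at a node, for two subsequences *)

Section Comparison.
Variables (R : realType) (N : (nat -> R) -> R).
Hypothesis hN : is_schlumprecht_norm N.
Local Notation f := (schlumprecht_f R).

Lemma blocks_comp P (b : nat -> nat -> R) (psi : nat -> nat) : blocks N P b ->
  {homo psi : i j / (i < j)%N} -> blocks N (P \o psi) (b \o psi).
Proof.
move=> [cb Nb hP Pb] hpsi.
have hpsi' i j : (i <= j)%N -> (psi i <= psi j)%N.
  by rewrite leq_eqVlt => /predU1P[->//|/hpsi/ltnW].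
split => [i|i|i j ij|i t /Pb/andP[Pt tP]] /=; first exact: cb.
- exact: Nb.
- by apply: hP; exact: hpsi'.
by rewrite Pt (leq_trans tP)// hP// hpsi.
Qed.

Lemma sumr_mul_le_Gam P (Z : nat -> nat -> R) a m (v : R) l k : blocks N P Z ->
  (0 < m)%N -> (forall i, (l <= i < k)%N -> v <= Gam N m (Z i)) -> (l < k)%N ->
  \sum_(l <= i < k) `|a i| * v <= Gam N ((k - l) * m) (bsum a Z l k).
Proof.
move=> hZ m0 hv; elim: k hv => // k IH hv; rewrite ltnS => lk.
have [cZ _ _ _] := hZ.
have h1 : `|a k| * v <= Gam N m (bsum a Z k k.+1).
  rewrite bsum1; apply: le_trans (Gam_cutZ hN _ _ _) => //.
  by apply: ler_wpM2l => //; apply: hv; lia.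
rewrite big_nat_recr//=; move: lk; rewrite leq_eqVlt => /predU1P[lk|lk].
  by rewrite -lk big_geq// add0r subSnn mul1n lk.
have {}IH := IH (fun i h => hv i ltac:(lia)) lk.
apply: (le_trans (lerD IH h1)); apply: le_trans (Gam_bsum_add hN a hZ _ _ _) _.
- lia.
- by rewrite muln_gt0 subn_gt0 lk.
- exact: m0.
by rewrite subSn ?(ltnW lk)// mulSn addnC.
Qed.

Lemma schlumprecht_f_sqr m : (0 < m)%N -> f (m * m) <= 4 * f m.
Proof.
move=> m0; have /andP[] := trunc_log_bounds (ltnSn 1) m0.
set e := trunc_log 2 m => em me.
have h1 : f (m * m) <= (e.+1 + e.+1)%:R.
  by apply: schlumprecht_f_le; rewrite expnD ltn_mul.
have h2 := schlumprecht_f_ge R em; have h3 := schlumprecht_f_ge1 R m0.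
apply: (le_trans h1); rewrite natrD -!natr1; lra.
Qed.

Variables (b : nat -> nat -> R) (P : nat -> nat).
Hypothesis hb : blocks N P b.
Variables (g : nat -> R) (Nk : nat -> nat).
Hypothesis Nk_mono : {homo Nk : i j / (i < j)%N}.
Hypothesis hB : forall k j, (j < k)%N -> forall s, k.+1%:R * cutsum N s (b j) <= f (Nk k).
Hypothesis hg : forall k m, (0 < m <= Nk k)%N -> `|Gam N m (b k) - g m| <= 1 / 2.

Variables (p q : nat -> nat).
Hypotheses (p_mono : {homo p : i j / (i < j)%N}) (q_mono : {homo q : i j / (i < j)%N}).
Hypotheses (p_bound : forall i, (i <= p i <= i.*2.+1)%N)
  (q_bound : forall i, (i <= q i <= i.*2.+1)%N).

Let Y := b \o p.
Let Z := b \o q.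
Let hY : blocks N (P \o p) Y := blocks_comp hb p_mono.
Let hZ : blocks N (P \o q) Z := blocks_comp hb q_mono.

Let cb i : c00 (b i). Proof. by case: hb. Qed.
Let Nb i : N (b i) = 1. Proof. by case: hb. Qed.

Lemma Nk_mono_le i j : (i <= j)%N -> (Nk i <= Nk j)%N.
Proof. by rewrite leq_eqVlt => /predU1P[->//|/Nk_mono/ltnW]. Qed.

Lemma leq_Nk i : (i <= Nk i)%N.
Proof. by elim: i => // i IH; exact: leq_ltn_trans (Nk_mono (ltnSn i)). Qed.

Let exk n : exists k, (n <= Nk k)%N. Proof. by exists n; exact: leq_Nk. Qed.
(** A generalized inverse of [Nk]: [kappa n = k0.+1] means [Nk k0 < n <= Nk k0.+1]. *)
Definition kappa n := ex_minn (exk n).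

(** Both profiles are within [1 / 2] of [g m], so they differ by at most 1, which is itself at most
    [Gam N m (Z i)]. *)
Lemma kappa_good n i m : (2 <= n)%N -> (kappa n <= i)%N -> (0 < m <= n)%N ->
  Gam N m (Y i) <= 2 * Gam N m (Z i).
Proof.
move=> n2; rewrite /kappa; case: ex_minnP => k nk _ ki /andP[m0 mn].
have mp : (0 < m <= Nk (p i))%N.
  have /andP[ip _] := p_bound i; rewrite m0 (leq_trans mn)//.
  by rewrite (leq_trans nk)// Nk_mono_le// (leq_trans ki).
have mq : (0 < m <= Nk (q i))%N.
  have /andP[iq _] := q_bound i; rewrite m0 (leq_trans mn)//.
  by rewrite (leq_trans nk)// Nk_mono_le// (leq_trans ki).
have := hg mp; have := hg mq; rewrite !ler_norml => /andP[? ?] /andP[? ?].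
have := Gam_ge1 hN cb Nb (q i) m0.
rewrite /Y /Z /=; lra.
Qed.

(** The early indices [i <= k0] are sorted by [p i]. Those with [p i < k0] are negligible by [hB],
    whose factor [k0.+1] makes up for their number; [p i = k0] occurs at most once; the late ones,
    [k0 < p i], are left to the hypothesis. *)
Lemma cutsum_bad (K : R) : 0 <= K ->
  (forall a s l k k0, (Nk k0 < (size s).+1 <= Nk k0.+1)%N -> (l <= k <= k0.+1)%N ->
    \sum_(l <= i < k | (k0 < p i)%N) `|a i| * cutsum N s (Y i)
      <= K * f (size s).+1 * N (bsum a Z l k)) ->
  forall a s l k, (0 < size s)%N -> (l <= k <= kappa (size s).+1)%N ->
  cutsum N s (bsum a Y l k) <= (2 + K) * f (size s).+1 * N (bsum a Z l k).
Proof.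
move=> K0 hK a s l k s0; rewrite /kappa; case: ex_minnP => -[|k0] nk0 k0min.
  rewrite leqn0 => /andP[_ /eqP ->].
  by rewrite !bsum_nil// (cutsum0 hN) (N0 hN) mulr0.
move=> lk; have /andP[lk' kk0] := lk.
have Nk0n : (Nk k0 < (size s).+1)%N.
  by rewrite ltnNge; apply/negP => /k0min; rewrite ltnn.
set n := (size s).+1 in nk0 k0min Nk0n *.
have n0 : (0 < n)%N by [].
have f0 : 0 < f n by exact: schlumprecht_f_gt0.
set z := N (bsum a Z l k).
have z0 : 0 <= z by apply: N_ge0 => //; exact: (c00_bsum a hZ).
have cY i : c00 (Y i) by exact: cb.
have az i : (l <= i < k)%N -> `|a i| <= z by exact: (norm_coef_le hN a hZ).
have Yf i : cutsum N s (Y i) <= f n.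
  by have := cutsum_le hN s (cY i); rewrite /Y /= Nb mulr1.
have Y0 i : 0 <= cutsum N s (Y i) by exact: cutsum_ge0.
have k1 : 0 < k0.+1%:R :> R by [].
apply: (le_trans (cutsum_sum hN _ _ _)); first by move=> i; exact: c00Z.
under eq_bigr do rewrite (cutsumZ hN)//.
apply: (@le_trans _ _ (\sum_(l <= i < k) z * f n / k0.+1%:R +
   \sum_(l <= i < k | p i == k0) z * f n +
   \sum_(l <= i < k | (k0 < p i)%N) `|a i| * cutsum N s (Y i))).
  rewrite [X in _ + X + _]big_mkcond [X in _ + X]big_mkcond -!big_split/=.
  rewrite big_nat [leRHS]big_nat; apply: ler_sum => i lik.
  have zf0 : 0 <= z * f n / k0.+1%:R.
    by apply: divr_ge0 => //; apply: mulr_ge0 => //; exact: ltW.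
  case: (ltngtP (p i) k0) => pik.
  - rewrite !addr0 -mulrA; apply: ler_pM => //; first exact: az.
    rewrite ler_pdivlMr// mulrC; apply: (le_trans (hB pik s)).
    by apply: schlumprecht_f_mono; exact: ltnW.
  - by rewrite addr0; exact: ler_wpDl.
  rewrite addr0; apply: ler_wpDl => //; apply: ler_pM => //; exact: az.
have -> : (2 + K) * f n * z = z * f n + z * f n + K * f n * z by ring.
apply: lerD; last by apply: hK => //; rewrite Nk0n nk0.
have zf0 : 0 <= z * f n by rewrite mulr_ge0// ltW.
apply: lerD; last first.
  have [[i lik /eqP pik]|noi] := pselect (exists2 i, (l <= i < k)%N & p i == k0).
    rewrite big_mkcond (bigD1_seq i) ?mem_index_iota ?iota_uniq//= pik eqxx.
    rewrite big1 ?addr0// => j ji; case: eqP => // pjk; exfalso.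
    have [ij|ij|ij] := ltngtP i j; last by rewrite ij eqxx in ji.
      by have := p_mono ij; rewrite pik pjk ltnn.
    by have := p_mono ij; rewrite pik pjk ltnn.
  rewrite big_nat_cond big1// => i /andP[lik pik].
  by exfalso; apply: noi; exists i.
rewrite sumr_const_nat -[leLHS]mulr_natr mulrAC ler_pdivrMr// ler_wpM2l//.
by rewrite ler_nat; lia.
Qed.

(** The case [g = o(f)]. A late vector still follows [g] at arity [n <= Nk k0.+1], so its pieces sum
    to at most [f n / k0.+1], and there are at most [k0.+1] of them. *)
Lemma late_small : (forall k n, (Nk k < n)%N -> g n + 1 / 2 <= f n / k.+1%:R) ->
  forall a s l k k0, (Nk k0 < (size s).+1 <= Nk k0.+1)%N -> (l <= k <= k0.+1)%N ->
    \sum_(l <= i < k | (k0 < p i)%N) `|a i| * cutsum N s (Y i)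
      <= 1 * f (size s).+1 * N (bsum a Z l k).
Proof.
move=> hs a s l k k0 /andP[Nkn nN] /andP[lk kk0]; set n := (size s).+1 in Nkn nN *.
set z := N (bsum a Z l k).
have z0 : 0 <= z by apply: N_ge0 => //; exact: (c00_bsum a hZ).
have f0 : 0 < f n by exact: schlumprecht_f_gt0.
have k1 : 0 < k0.+1%:R :> R by [].
apply: (@le_trans _ _ (\sum_(l <= i < k) z * (f n / k0.+1%:R))).
  rewrite big_mkcond big_nat [leRHS]big_nat; apply: ler_sum => i lik.
  case: ifPn => pik; last first.
    by apply: mulr_ge0 => //; apply: divr_ge0 => //; exact: ltW.
  apply: ler_pM => //; [exact: (cutsum_ge0 hN _ (cb _))|exact: (norm_coef_le hN a hZ)|].
  apply: le_trans (hs _ _ Nkn); apply: (@le_trans _ _ (Gam N n (b (p i)))).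
    exact: (Gam_ub hN (cb (p i)) (ltnSn _)).
  have : `|Gam N n (b (p i)) - g n| <= 1 / 2.
    by apply: hg; rewrite (leq_trans nN)//= Nk_mono_le.
  by rewrite ler_norml => /andP[_]; lra.
rewrite sumr_const_nat -[leLHS]mulr_natr mul1r [leRHS]mulrC -[leLHS]mulrA.
apply: ler_wpM2l => //; rewrite mulrAC ler_pdivrMr//.
by apply: ler_wpM2l; [exact: ltW|rewrite ler_nat; lia].
Qed.

(* Here [i <= k0 <= 2i]: the [Z i] still have the profile [g] at arity [m], and
   cutting each of them into [m] pieces exhibits an l1-sum. *)
Lemma late_large (c : R) : 0 < c ->
  (forall k, exists2 m, (k.*2.+1 <= m <= Nk k)%N & c * f m <= g m) ->
  forall a s l k k0, (Nk k0 < (size s).+1 <= Nk k0.+1)%N -> (l <= k <= k0.+1)%N ->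
    \sum_(l <= i < k | (k0 < p i)%N) `|a i| * cutsum N s (Y i)
      <= 8 / c * f (size s).+1 * N (bsum a Z l k).
Proof.
move=> c0 hc a s l k k0 _ /andP[lk kk0]; set n := (size s).+1.
set z := N (bsum a Z l k).
have z0 : 0 <= z by apply: N_ge0 => //; exact: (c00_bsum a hZ).
have f0 : 0 < f n by exact: schlumprecht_f_gt0.
have cY i : c00 (Y i) by exact: cb.
have Yf i : cutsum N s (Y i) <= f n.
  by have := cutsum_le hN s (cY i); rewrite /Y /= Nb mulr1.
have Y0 i : 0 <= cutsum N s (Y i) by exact: cutsum_ge0.
(* Because [p i <= 2 * i + 1], the condition [k0 < p i] gives [h <= i]. *)
pose h := uphalf k0; pose l' := maxn l h.
have hk : (k0 <= h.*2)%N by rewrite /h; lia.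
have rhs0 : 0 <= 8 / c * f n * z.
  by rewrite mulr_ge0// mulr_ge0 ?(ltW f0)// divr_ge0// ltW.
have [kl'|l'k] := leqP k l'.
  rewrite big_nat_cond big1// => i /andP[/andP[li ik] pik]; exfalso.
  have ih : (i < h)%N.
    by have := leq_trans ik kl'; rewrite /l' leq_max ltnNge li.
  have /andP[_ pi] := p_bound i.
  by have := leq_trans pik (leq_trans pi (double_lt_uphalf ih)); rewrite ltnn.
(* As [m >= 2 * h + 1], it is at least the number of late indices, so [m * m] pieces suffice for all
   of them; as [m <= Nk h], every [Z i] with [h <= i] follows [g] at [m]. *)
have [m /andP[hm mN] cm] := hc h.
have m0 : (0 < m)%N by lia.
have fm0 : 0 < f m by exact: schlumprecht_f_gt0.
have Gm i : (l' <= i < k)%N -> c * f m / 2 <= Gam N m (Z i).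
  move=> /andP[li _]; have hi : (h <= i)%N by move: li; rewrite /l'; lia.
  have /andP[iq _] := q_bound i.
  have : `|Gam N m (b (q i)) - g m| <= 1 / 2.
    apply: hg; rewrite m0 (leq_trans mN)// Nk_mono_le//; exact: leq_trans iq.
  have := Gam_ge1 hN cb Nb (q i) m0.
  by rewrite ler_norml /Z /= => ? /andP[? _]; lra.
have G1 := sumr_mul_le_Gam a hZ m0 Gm l'k.
have z'z : N (bsum a Z l' k) <= z.
  by apply: (N_bsum_sub hN a hZ); rewrite ?leqnn// /l' leq_maxl ltnW.
have z'0 : 0 <= N (bsum a Z l' k) by apply: N_ge0 => //; exact: (c00_bsum a hZ).
have G2 : Gam N ((k - l') * m) (bsum a Z l' k) <= 4 * f m * z.
  have km : (0 < (k - l') * m)%N by rewrite muln_gt0 subn_gt0 l'k.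
  apply: (le_trans (Gam_bound hN (c00_bsum a hZ _ _) km)).
  apply: ler_pM => //; first by rewrite ltW// schlumprecht_f_gt0.
  apply: le_trans (schlumprecht_f_sqr m0); apply: schlumprecht_f_mono.
  by rewrite leq_mul2r (late_range_le _ kk0 hk hm) orbT.
have S1 : \sum_(l' <= i < k) `|a i| <= 8 / c * z.
  have : (\sum_(l' <= i < k) `|a i|) * (c * f m / 2) <= 4 * f m * z.
    by rewrite mulr_suml; exact: le_trans G2.
  have -> : 4 * f m * z = 8 / c * z * (c * f m / 2).
    by move: (f m) => u; field; rewrite gt_eqF.
  by rewrite ler_pM2r// divr_gt0// mulr_gt0.
apply: (@le_trans _ _ ((\sum_(l' <= i < k) `|a i|) * f n)); last first.
  by rewrite mulrAC ler_wpM2r// ltW.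
rewrite mulr_suml (big_cat_nat (n := l')) ?leq_maxl//=; last exact: ltnW.
rewrite big_nat_cond big1 ?add0r => [|i /andP[/andP[li il] pik]]; last first.
  have ih : (i < h)%N by move: il; rewrite /l' leq_max ltnNge li.
  have /andP[_ pi] := p_bound i.
  by have := leq_trans pik (leq_trans pi (double_lt_uphalf ih)); rewrite ltnn.
rewrite big_mkcond; apply: ler_sum => i _; case: ifP => _.
  exact: ler_wpM2l.
by rewrite mulr_ge0// ltW.
Qed.

End Comparison.

Lemma exists_comparable_subsequence (R : realType) (N : (nat -> R) -> R)
    (b : nat -> nat -> R) (P : nat -> nat) :
  is_schlumprecht_norm N -> blocks N P b ->
  exists2 psi : nat -> nat, {homo psi : i j / (i < j)%N} &
    forall p q : nat -> nat,
      {homo p : i j / (i < j)%N} -> {homo q : i j / (i < j)%N} ->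
      (forall i, (i <= p i <= i.*2.+1)%N) -> (forall i, (i <= q i <= i.*2.+1)%N) ->
      exists D, forall a r, N (bsum a (b \o psi \o p) 0 r) <=
                        D * N (bsum a (b \o psi \o q) 0 r).
Proof.
move=> hN hb; have [cb Nb _ _] := hb.
have [g hg] := Gam_profile hN cb Nb.
have [B hB] := exists_bound hN cb.
have main (Q : nat -> nat -> Prop) (K : R) : 0 <= K ->
    (forall k, exists M, forall n, (M <= n)%N -> Q k n) ->
    (forall (Nk : nat -> nat) psi, {homo Nk : i j / (i < j)%N} ->
      {homo psi : i j / (i < j)%N} -> (forall k, Q k (Nk k)) ->
      (forall k m, (0 < m <= Nk k)%N -> `|Gam N m ((b \o psi) k) - g m| <= 1 / 2) ->
      forall p q : nat -> nat,
      {homo p : i j / (i < j)%N} -> {homo q : i j / (i < j)%N} ->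
      (forall i, (i <= p i <= i.*2.+1)%N) -> (forall i, (i <= q i <= i.*2.+1)%N) ->
      forall a s l k k0, (Nk k0 < (size s).+1 <= Nk k0.+1)%N -> (l <= k <= k0.+1)%N ->
      \sum_(l <= i < k | (k0 < p i)%N) `|a i| * cutsum N s ((b \o psi \o p) i)
        <= K * schlumprecht_f R (size s).+1 * N (bsum a (b \o psi \o q) l k)) ->
    exists2 psi : nat -> nat, {homo psi : i j / (i < j)%N} &
    forall p q : nat -> nat,
      {homo p : i j / (i < j)%N} -> {homo q : i j / (i < j)%N} ->
      (forall i, (i <= p i <= i.*2.+1)%N) -> (forall i, (i <= q i <= i.*2.+1)%N) ->
      exists D, forall a r, N (bsum a (b \o psi \o p) 0 r) <=
                        D * N (bsum a (b \o psi \o q) 0 r).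
  move=> K0 hQ late.
  have [Nk [psi [Nkm psim QNk BNk gNk]]] := exists_subsequence B hQ hg.
  exists psi => // p q pm qm pb qb.
  have hb' := blocks_comp hb psim.
  have hB' k j : (j < k)%N -> forall s,
      k.+1%:R * cutsum N s ((b \o psi) j) <= schlumprecht_f R (Nk k).
    by move=> jk s; apply: le_trans (BNk _ _ jk); apply: ler_wpM2l => //; exact: hB.
  have late' := late Nk psi Nkm psim QNk gNk p q pm qm pb qb.
  apply: (block_domination hN (blocks_comp hb' pm) (blocks_comp hb' qm) (K := 2 + K)
    (kappa := kappa Nkm)).
  - by rewrite addr_ge0.
  - exact: (kappa_good hN hb' gNk pb qb).
  - exact: (cutsum_bad hN hb' hB' pm qm K0 late').
(* Either the limit profile [g] is infinitely often comparable to [f], or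
   [g = o(f)]. *)
have [[c c0 hc]|noc] := pselect (exists2 c : R, 0 < c &
    forall M, exists2 m, (M <= m)%N & c * schlumprecht_f R m <= g m).
  pose Q k n := exists2 m, (k.*2.+1 <= m <= n)%N & c * schlumprecht_f R m <= g m.
  apply: (main Q (8 / c)); first by rewrite divr_ge0// ltW.
    move=> k; have [m km cm] := hc k.*2.+1.
    by exists m => n mn; exists m => //; rewrite km.
  move=> Nk psi Nkm psim QNk gNk p q pm qm pb qb.
  exact: (late_large hN (blocks_comp hb psim) Nkm gNk qm pb qb c0 QNk).
pose Q k M := forall n, (M < n)%N -> g n + 1 / 2 <= schlumprecht_f R n / k.+1%:R.
apply: (main Q 1) => //.
  (* Half of [1 / k.+1] is for [g]; the other half absorbs the error [1 / 2] once [f n >= k.+1]. *)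
  move=> k; pose c : R := (2 * k.+1%:R)^-1.
  have c0 : 0 < c by rewrite invr_gt0.
  have [M1 hM1] : exists M1, forall m, (M1 <= m)%N -> g m <= c * schlumprecht_f R m.
    apply: contrapT => nM; apply: noc; exists c => // M.
    apply: contrapT => nm; apply: nM; exists M => m Mm.
    rewrite leNgt; apply/negP => /ltW cg; apply: nm; by exists m.
  have [M2 hM2] := f_large (k.+1%:R : R).
  exists (maxn M1 M2) => n Mn n' nn'.
  have /hM1 h1 : (M1 <= n')%N by lia.
  have /hM2 h2 : (M2 <= n')%N by lia.
  have k0 : 0 < k.+1%:R :> R by [].
  have h3 : 1 / 2 <= c * schlumprecht_f R n'.
    rewrite /c ler_pdivlMl ?mulr_gt0//; lra.
  apply: (le_trans (lerD h1 h3)).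
  rewrite le_eqVlt; apply/orP; left; apply/eqP; rewrite /c.
  by move: (schlumprecht_f R n') => u; field; rewrite gt_eqF.
move=> Nk psi Nkm psim QNk gNk p q pm qm pb qb.
exact: (late_small hN (blocks_comp hb psim) Nkm gNk p qm QNk).
Qed.

(** * Isomorphisms between closed spans *)

Section ClosedSpan.
Variable R : realType.

Definition comb (V : lmodType R) n (a : nat -> R) (u : nat -> V) : V :=
  \sum_(i < n) a i *: u i.

Definition pad n (a : nat -> R) i : R := if (i < n)%N then a i else 0.

Lemma comb_pad (V : lmodType R) n m a (u : nat -> V) : (n <= m)%N ->
  comb n a u = comb m (pad n a) u.
Proof.
move=> nm; have E k c : comb k c u = \sum_(0 <= i < k) c i *: u i.
  by rewrite /comb big_mkord.
rewrite !E [RHS](big_cat_nat (n := n))//= [X in _ + X]big_nat_cond.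
rewrite [X in _ + X]big1 ?addr0.
  by apply: eq_big_nat => i /andP[_ ilt]; rewrite /pad ilt.
by move=> i /andP[/andP[ni _] _]; rewrite /pad ltnNge ni scale0r.
Qed.

Lemma comb_linear (V : lmodType R) n c a b (u : nat -> V) :
  c *: comb n a u + comb n b u = comb n (fun i => c * a i + b i) u.
Proof.
rewrite /comb scaler_sumr -big_split; apply: eq_bigr => i _ /=.
by rewrite scalerDl scalerA.
Qed.

(** The coefficients are chosen before [V] and [u], so that the same ones serve both sides of a
    graph. *)
Lemma comb_combine n m c a b : exists k d, forall (V : lmodType R) (u : nat -> V),
  c *: comb n a u + comb m b u = comb k d u.
Proof.
exists (maxn n m), (fun i => c * pad n a i + pad m b i) => V u.
by rewrite -comb_linear -!comb_pad ?leq_maxl ?leq_maxr.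
Qed.

Lemma closed_spanP (V : normedModType R) (u : nat -> V) v :
  closed_span u v <-> forall e : R, 0 < e -> exists n a, `|v - comb n a u| < e.
Proof.
split=> [cl e e0|h B].
  have [_ [[n [a ->]] /=]] := cl _ (nbhsx_ballx v e e0).
  by rewrite -ball_normE /= => ve; exists n, a.
move=> /nbhs_ballP[e /= e0 eB]; have [n [a va]] := h e e0.
exists (comb n a u); split; first by exists n, a.
by apply: eB; rewrite -ball_normE.
Qed.

Lemma closed_span_comb (V : normedModType R) (u : nat -> V) n a :
  closed_span u (comb n a u).
Proof. by apply/closed_spanP => e e0; exists n, a; rewrite subrr normr0. Qed.

(* The closure of the graph of [comb n a u |-> comb n a w]. *)
Definition gr (V W : normedModType R) (u : nat -> V) (w : nat -> W) v z :=
  forall e : R, 0 < e ->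
    exists n a, `|v - comb n a u| < e /\ `|z - comb n a w| < e.

Lemma norm_lin_lt (V : normedModType R) (c : R) (v v' s s' : V) (e : R) :
  `|v - s| < e / (2 * (`|c| + 1)) -> `|v' - s'| < e / 2 -> 0 < e ->
  `|c *: v + v' - (c *: s + s')| < e.
Proof.
move=> h1 h2 e0; have c1 : 0 < `|c| + 1 by rewrite ltr_wpDl.
rewrite opprD addrACA -scalerBr; apply: le_lt_trans (ler_normD _ _) _.
rewrite normrZ [ltRHS](splitr e); apply: ler_ltD => //.
apply: (@le_trans _ _ ((`|c| + 1) * (e / (2 * (`|c| + 1))))).
  by apply: ler_pM => //; [rewrite lerDl|exact: ltW].
by rewrite le_eqVlt; apply/orP; left; apply/eqP; field; rewrite gt_eqF.
Qed.

Lemma gr_linear (V W : normedModType R) (u : nat -> V) (w : nat -> W) c v z v' z' :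
  gr u w v z -> gr u w v' z' -> gr u w (c *: v + v') (c *: z + z').
Proof.
move=> h h' e e0; have c1 : 0 < `|c| + 1 by rewrite ltr_wpDl.
have e1 : 0 < e / (2 * (`|c| + 1)) by rewrite divr_gt0// mulr_gt0.
have e2 : 0 < e / 2 by rewrite divr_gt0.
have [n [a [va za]]] := h _ e1; have [m [b [vb zb]]] := h' _ e2.
have [k [d kd]] := comb_combine n m c a b; exists k, d; rewrite -!kd.
by split; exact: norm_lin_lt.
Qed.

Lemma closed_span_linear (V : normedModType R) (u : nat -> V) c v v' :
  closed_span u v -> closed_span u v' -> closed_span u (c *: v + v').
Proof.
move=> /closed_spanP h /closed_spanP h'; apply/closed_spanP => e e0.
have g t : (forall e, 0 < e -> exists n a, `|t - comb n a u| < e) -> gr u u t t.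
  by move=> ht r r0; have [n [a ta]] := ht r r0; exists n, a.
by have [n [a [? _]]] := gr_linear c (g _ h) (g _ h') e0; exists n, a.
Qed.

Section Extension.
Variables (V : normedModType R) (W : completeNormedModType R).
Variables (u : nat -> V) (w : nat -> W) (C : R).
Hypotheses (C0 : 0 <= C) (hC : forall n a, `|comb n a w| <= C * `|comb n a u|).

Lemma gr_bound v z : gr u w v z -> `|z| <= C * `|v|.
Proof.
move=> h; apply/ler_addgt0Pr => e e0.
have C1 : 0 < C + 1 by rewrite ltr_wpDl.
have d0 : 0 < e / (C + 1) by rewrite divr_gt0.
have [n [a [va za]]] := h _ d0; set d := e / (C + 1) in d0 va za.
have dE : d * (C + 1) = e by rewrite /d mulfVK// gt_eqF.
have h1 : `|z| <= `|z - comb n a w| + `|comb n a w|.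
  by rewrite -{1}(subrK (comb n a w) z) ler_normD.
have h2 : `|comb n a u| <= `|v - comb n a u| + `|v|.
  by rewrite -{1}(subKr v (comb n a u)) (le_trans (ler_normB _ _))// addrC.
have := hC n a; have := ler_wpM2l C0 (le_trans h2 (lerD (ltW va) (lexx _))).
by nra.
Qed.

Lemma gr_uniq v z z' : gr u w v z -> gr u w v z' -> z = z'.
Proof.
move=> h h'; have := gr_bound (gr_linear (-1) h h').
rewrite !scaleN1r addNr normr0 mulr0 normr_le0 addrC subr_eq0.
by move/eqP.
Qed.

(** By [hC] the images of combinations converging to [v] form a Cauchy sequence; completeness of [W]
    provides the limit. *)
Lemma gr_exists v : closed_span u v -> exists z, gr u w v z.
Proof.
move=> /closed_spanP hv.
have hk k : exists na : nat * (nat -> R), `|v - comb na.1 na.2 u| < k.+1%:R^-1.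
  have [|n [a va]] := hv k.+1%:R^-1; first by rewrite invr_gt0.
  by exists (n, a).
have [F hF] := choice hk.
pose s k := comb (F k).1 (F k).2 w.
have sC k l : (k <= l)%N -> `|s k - s l| <= C * (2 / k.+1%:R).
  move=> kl; have [m [d hd]] := comb_combine (F l).1 (F k).1 (-1) (F l).2 (F k).2.
  have -> : s k - s l = comb m d w by rewrite -hd scaleN1r addrC.
  apply: le_trans (hC _ _) _; apply: ler_wpM2l => //; rewrite -hd scaleN1r addrC.
  apply: le_trans (ler_distD v _ _) _; rewrite [X in X + _]distrC.
  have lk : l.+1%:R^-1 <= k.+1%:R^-1 :> R by rewrite lef_pV2 ?posrE// ler_nat.
  rewrite mulr_natl mulr2n; apply: lerD; first exact: ltW (hF k).
  exact: le_trans (ltW (hF l)) lk.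
have e_large (e : R) : 0 < e -> exists k, forall l, (k <= l)%N -> (l.+1%:R)^-1 < e.
  move=> e0; exists (Num.bound e^-1) => l kl.
  rewrite -[ltRHS]invrK ltf_pV2 ?posrE ?invr_gt0//.
  apply: (lt_trans (archi_boundP _)); first by rewrite invr_ge0 ltW.
  by rewrite ltr_nat ltnS.
have cs : cvg (s @ \oo).
  apply/cauchy_cvgP/cauchy_exP => e e0.
  have C1 : 0 < 2 * C + 1 by rewrite ltr_wpDl// mulr_ge0.
  have [k hk'] := e_large (e / (2 * C + 1)) (divr_gt0 e0 C1).
  exists (s k); exists k => // l /= kl; rewrite -ball_normE /=.
  apply: le_lt_trans (sC k l kl) _.
  have k0 : 0 < k.+1%:R^-1 :> R by rewrite invr_gt0.
  have := hk' k (leqnn k); rewrite ltr_pdivlMr//.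
  by move: (k.+1%:R^-1) k0 => t t0; lra.
exists (lim (s @ \oo)) => e e0.
have [k hk'] := e_large e e0.
have /cvgrPdist_lt/(_ e e0)[m _ hm] := cs.
exists (F (maxn k m)).1, (F (maxn k m)).2; split.
  by apply: lt_trans (hF _) _; apply: hk'; exact: leq_maxl.
by apply: (hm (maxn k m)); exact: leq_maxr.
Qed.

Lemma bounded_extension : exists T : V -> W,
  [/\ forall c v v', closed_span u v -> closed_span u v' ->
        T (c *: v + v') = c *: T v + T v',
      forall v, closed_span u v -> `|T v| <= C * `|v|,
      forall n a, T (comb n a u) = comb n a w
    & forall v, closed_span u v -> closed_span w (T v)].
Proof.
(* Off the closed span [T] may take any value; the default is 0. *)
have /choice[T hT] : forall v, exists z, closed_span u v -> gr u w v z.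
  move=> v; have [/gr_exists[z vz]|nv] := pselect (closed_span u v); first by exists z.
  by exists 0.
exists T; split=> [c v v' hv hv'|v /hT/gr_bound//|n a|v /hT h].
- apply: (gr_uniq (hT _ (closed_span_linear hv hv'))).
  by apply: gr_linear; exact: hT.
- apply: (@gr_uniq (comb n a u)) => [|e e0].
    by apply: hT; exact: closed_span_comb.
  by exists n, a; rewrite !subrr !normr0.
apply/closed_spanP => e e0; have [n [a [_ ?]]] := h e e0.
by exists n, a.
Qed.

End Extension.

Lemma bounded_linear_within_continuous (V W : normedModType R) (u : nat -> V)
    (T : V -> W) (C : R) : 0 <= C ->
  (forall c v v', closed_span u v -> closed_span u v' ->
     T (c *: v + v') = c *: T v + T v') ->
  (forall v, closed_span u v -> `|T v| <= C * `|v|) ->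
  {within closed_span u, continuous T}.
Proof.
move=> C0 Tlin Tb; apply/subspace_continuousP => v hv.
apply/cvgrPdist_lt => e e0; have C1 : 0 < C + 1 by rewrite ltr_wpDl.
apply/nbhs_ballP; exists (e / (C + 1)) => /=; first by rewrite divr_gt0.
move=> v' vv' hv'; have -> : T v - T v' = T (v - v').
  have -> : v - v' = -1 *: v' + v by rewrite scaleN1r addrC.
  by rewrite Tlin// scaleN1r addrC.
have hd : closed_span u (v - v').
  by rewrite addrC -scaleN1r; exact: closed_span_linear.
apply: le_lt_trans (Tb _ hd) _.
move: vv'; rewrite -ball_normE /= ltr_pdivlMr// => h.
have := normr_ge0 (v - v'); nra.
Qed.

Lemma fixes_closed_span (V : normedModType R) (u : nat -> V) (T : V -> V) (C : R) :
  0 <= C ->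
  (forall c v v', closed_span u v -> closed_span u v' ->
     T (c *: v + v') = c *: T v + T v') ->
  (forall v, closed_span u v -> `|T v| <= C * `|v|) ->
  (forall n a, T (comb n a u) = comb n a u) ->
  forall v, closed_span u v -> T v = v.
Proof.
move=> C0 Tlin Tb Tf v hv; apply/eqP; rewrite -subr_eq0 -normr_le0.
apply/ler_addgt0Pr => e e0; rewrite add0r.
have C1 : 0 < C + 1 by rewrite ltr_wpDl.
have d0 : 0 < e / (C + 1) by rewrite divr_gt0.
have /closed_spanP/(_ _ d0)[n [a]] := hv; set s := comb n a u => vs.
have hs : closed_span u s by exact: closed_span_comb.
have hd : closed_span u (v - s).
  by rewrite addrC -scaleN1r; exact: closed_span_linear.
have Tv : T v = T (v - s) + s.
  have E : v = 1 *: (v - s) + s by rewrite scale1r subrK.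
  by rewrite {1}E Tlin// scale1r Tf.
have -> : T v - v = T (v - s) - (v - s) by rewrite Tv opprB addrA addrAC.
apply: le_trans (ler_normB _ _) _; have := Tb _ hd.
move: vs; rewrite ltr_pdivlMr// => vs h; have := normr_ge0 (v - s); nra.
Qed.

End ClosedSpan.

(** * The square of the span of a sequence equivalent to its even and odd parts *)

Section Square.
Variable R : realType.

(** The pairs [(evens u i, odds u i)] run through [(u 0, 0)], [(0, u 0)], [(u 1, 0)], [(0, u 1)],
    and so on: they are the images of the [u i] under the isomorphism onto the square. *)
Definition evens (V : lmodType R) (u : nat -> V) i : V := if odd i then 0 else u i./2.
Definition odds (V : lmodType R) (u : nat -> V) i : V := if odd i then u i./2 else 0.

Lemma comb_double (V : lmodType R) m a (u : nat -> V) :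
  comb m.*2 a u = comb m (fun i => a i.*2) (fun i => u i.*2) +
                  comb m (fun i => a i.*2.+1) (fun i => u i.*2.+1).
Proof.
elim: m => [|m IH]; first by rewrite /comb !big_ord0 addr0.
have recr k c (z : nat -> V) : comb k.+1 c z = comb k c z + c k *: z k.
  by rewrite /comb big_ord_recr.
by rewrite doubleS !recr IH -!addrA; congr (_ + _); rewrite addrCA.
Qed.

Lemma comb0 (V : lmodType R) m a : comb m a (fun=> 0 : V) = 0.
Proof. by rewrite /comb big1// => i _; rewrite scaler0. Qed.

Lemma eq_comb (V : lmodType R) m a b (u w : nat -> V) : a =1 b -> u =1 w ->
  comb m a u = comb m b w.
Proof. by move=> ab uw; apply: eq_bigr => i _; rewrite ab uw. Qed.

Lemma comb_evens (V : lmodType R) m a (u : nat -> V) :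
  comb m.*2 a (evens u) = comb m (fun i => a i.*2) u.
Proof.
rewrite comb_double [X in _ + X](_ : _ = comb m (fun i => a i.*2.+1) (fun=> 0)).
  rewrite comb0 addr0; apply: eq_comb => // i.
  by rewrite /evens odd_double doubleK.
by apply: eq_comb => // i; rewrite /evens /= odd_double.
Qed.

Lemma comb_odds (V : lmodType R) m a (u : nat -> V) :
  comb m.*2 a (odds u) = comb m (fun i => a i.*2.+1) u.
Proof.
rewrite comb_double [X in X + _](_ : _ = comb m (fun i => a i.*2) (fun=> 0)).
  rewrite comb0 add0r; apply: eq_comb => // i.
  by rewrite /odds /= odd_double /= uphalf_double.
by apply: eq_comb => // i; rewrite /odds odd_double.
Qed.

Lemma comb_pair (V W : normedModType R) n a (u : nat -> V) (w : nat -> W) :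
  comb n a (fun i => (u i, w i)) = (comb n a u, comb n a w) :> V * W.
Proof.
elim: n => [|n IH]; first by rewrite /comb !big_ord0.
by move: IH; rewrite /comb !big_ord_recr /= => ->.
Qed.

Lemma comb_pad_double (V : lmodType R) n a (u : nat -> V) :
  comb n a u = comb n.*2 (pad n a) u.
Proof. by rewrite -comb_pad// -addnn leq_addr. Qed.

Variables (S : completeNormedModType R) (u : nat -> S) (D : R).
Hypothesis D0 : 0 <= D.
Local Notation ue := (fun i => u i.*2).
Local Notation uo := (fun i => u i.*2.+1).
Hypotheses (le_even : forall m a, `|comb m a u| <= D * `|comb m a ue|)
  (even_le : forall m a, `|comb m a ue| <= D * `|comb m a u|)
  (le_odd : forall m a, `|comb m a u| <= D * `|comb m a uo|)
  (odd_le : forall m a, `|comb m a uo| <= D * `|comb m a u|)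
  (even_proj : forall m a, `|comb m (fun i => a i.*2) ue| <= `|comb m.*2 a u|)
  (odd_proj : forall m a, `|comb m (fun i => a i.*2.+1) uo| <= `|comb m.*2 a u|).

Local Notation eo := (fun i => (evens u i, odds u i) : S * S).

(** The map is the projection onto the even vectors, bounded by [even_proj], followed by the
    relabelling of [u i.*2] as [u i], bounded by [le_even]. *)
Lemma norm_comb_evens n a : `|comb n a (evens u)| <= D * `|comb n a u|.
Proof.
rewrite !(comb_pad_double n) comb_evens; apply: le_trans (le_even _ _) _.
by apply: ler_wpM2l => //; exact: even_proj.
Qed.

Lemma norm_comb_odds n a : `|comb n a (odds u)| <= D * `|comb n a u|.
Proof.
rewrite !(comb_pad_double n) comb_odds; apply: le_trans (le_odd _ _) _.
by apply: ler_wpM2l => //; exact: odd_proj.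
Qed.

Lemma norm_comb_pair n a : `|comb n a u| <= (2 * D) * `|comb n a eo|.
Proof.
rewrite !(comb_pad_double n) comb_pair prod_normE /= comb_evens comb_odds comb_double.
set b := fun i => _; set c := fun i => pad n a i.*2.+1.
apply: le_trans (ler_normD _ _) _.
have h1 := even_le n b; have h2 := odd_le n c.
have h3 : `|comb n b u| <= Num.max `|comb n b u| `|comb n c u| by rewrite le_max lexx.
have h4 : `|comb n c u| <= Num.max `|comb n b u| `|comb n c u| by rewrite le_max lexx orbT.
have := ler_wpM2l D0 h3; have := ler_wpM2l D0 h4; lra.
Qed.

Lemma closed_span_evens v : closed_span (evens u) v -> closed_span u v.
Proof.
move=> /closed_spanP h; apply/closed_spanP => e e0.
have [n [a]] := h e e0; rewrite comb_pad_double comb_evens => ?.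
by exists n, (fun i => pad n a i.*2).
Qed.

Lemma closed_span_odds v : closed_span (odds u) v -> closed_span u v.
Proof.
move=> /closed_spanP h; apply/closed_spanP => e e0.
have [n [a]] := h e e0; rewrite comb_pad_double comb_odds => ?.
by exists n, (fun i => pad n a i.*2.+1).
Qed.

Lemma closed_span_pair : closed_span eo = closed_span u `*` closed_span u.
Proof.
apply/seteqP; split => -[v v'].
  move=> /closed_spanP h; split => /=; apply/closed_spanP => e e0.
    have [n [a]] := h e e0; rewrite comb_pair prod_normE /= gt_max => /andP[ha _].
    exists n, (fun i => pad n a i.*2); move: ha.
    by rewrite comb_pad_double comb_evens.
  have [n [a]] := h e e0; rewrite comb_pair prod_normE /= gt_max => /andP[_ ha].
  exists n, (fun i => pad n a i.*2.+1); move: ha.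
  by rewrite comb_pad_double comb_odds.
move=> [/closed_spanP h /closed_spanP h'] /=; apply/closed_spanP => e e0.
have [n [a va]] := h e e0; have [m [b vb]] := h' e e0.
pose k := maxn n m.
pose d i := if odd i then pad m b i./2 else pad n a i./2.
exists k.*2, d; rewrite comb_pair prod_normE /= gt_max comb_evens comb_odds.
have -> : comb k (fun i => d i.*2) u = comb n a u.
  rewrite (comb_pad a u (leq_maxl n m)); apply: eq_comb => // i.
  by rewrite /d odd_double doubleK.
have -> : comb k (fun i => d i.*2.+1) u = comb m b u.
  rewrite (comb_pad b u (leq_maxr n m)); apply: eq_comb => // i.
  by rewrite /d /= odd_double /= uphalf_double.
by rewrite va vb.
Qed.

(** The extensions of [u i |-> eo i] and of its inverse compose to the identity on finite
    combinations, hence on the closed spans by density and boundedness. *)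
Lemma isomorphic_square :
  isomorphic_subspaces (closed_span u) (closed_span u `*` closed_span u).
Proof.
have [T1 [T1lin T1b T1c T1s]] := bounded_extension D0 norm_comb_evens.
have [T2 [T2lin T2b T2c T2s]] := bounded_extension D0 norm_comb_odds.
have DD0 : 0 <= 2 * D by rewrite mulr_ge0.
have [U [Ulin Ub Uc Us]] := bounded_extension DD0 norm_comb_pair.
rewrite -closed_span_pair.
pose T v := (T1 v, T2 v) : S * S.
have Tlin c v v' : closed_span u v -> closed_span u v' ->
    T (c *: v + v') = c *: T v + T v'.
  by move=> hv hv'; rewrite /T T1lin// T2lin.
have Tb v : closed_span u v -> `|T v| <= D * `|v|.
  by move=> hv; rewrite prod_normE /= ge_max T1b// T2b.
have Tc n a : T (comb n a u) = comb n a eo by rewrite /T T1c T2c comb_pair.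
have Ts v : closed_span u v -> closed_span eo (T v).
  move=> hv; rewrite closed_span_pair; split => /=.
    by apply: closed_span_evens; exact: T1s.
  by apply: closed_span_odds; exact: T2s.
exists T, U; split.
- by split => [v hv|v hv]; [exact: Ts|exact: Us].
- split => v /set_mem hv.
    apply: (@fixes_closed_span _ _ u (U \o T) (2 * D * D)) => //.
    + by rewrite mulr_ge0.
    + by move=> c z z' hz hz' /=; rewrite Tlin// Ulin//; exact: Ts.
    + move=> z hz /=; apply: le_trans (Ub _ (Ts _ hz)) _.
      by rewrite -[leRHS]mulrA; apply: ler_wpM2l => //; exact: Tb.
    + by move=> n a /=; rewrite Tc Uc.
  apply: (@fixes_closed_span _ _ eo (T \o U) (D * (2 * D))) => //.
  + by rewrite mulr_ge0.
  + by move=> c z z' hz hz' /=; rewrite Ulin// Tlin//; exact: Us.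
  + move=> z hz /=; apply: le_trans (Tb _ (Us _ hz)) _.
    by rewrite -[leRHS]mulrA; apply: ler_wpM2l => //; exact: Ub.
  + by move=> n a /=; rewrite Uc Tc.
- by move=> c v v'; exact: Tlin.
- exact: (bounded_linear_within_continuous D0 Tlin Tb).
- exact: (bounded_linear_within_continuous DD0 Ulin Ub).
Qed.

End Square.

(** * Coordinate projections and normalization of block sequences *)

Section BlockSequences.
Variables (R : realType) (N : (nat -> R) -> R).
Hypothesis hN : is_schlumprecht_norm N.

Lemma bsumE a Y n : bsum a Y 0 n = comb n a Y :> (nat -> R).
Proof. by rewrite /bsum /comb big_mkord. Qed.

(** The blocks have disjoint supports, so deleting some of them restricts the coordinates to a set
    [E], and unconditionality applies. *)
Lemma N_comb_mask P (Y : nat -> nat -> R) (Q : pred nat) a n : blocks N P Y ->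
  N (comb n (fun i => if Q i then a i else 0) Y) <= N (comb n a Y).
Proof.
move=> hY; have [cY _ hP YP] := hY.
have Yinj i j t : Y i t != 0 -> Y j t != 0 -> i = j.
  move=> /YP hi /YP hj; have [ij|ji|//] := ltngtP i j.
    by have := hP _ _ ij; lia.
  by have := hP _ _ ji; lia.
pose E t := `[< exists2 i, Q i & Y i t != 0 >].
rewrite (_ : comb n (fun i => if Q i then a i else 0) Y = keep E (comb n a Y)).
  by apply: N_keep => //; rewrite -bsumE; exact: (c00_bsum a hY).
apply/funext => t; rewrite /keep /comb !fct_sumE.
case: ifPn => [/asboolP[j Qj Yj]|/asboolPn nE].
  apply: eq_bigr => i _; rewrite -[LHS]/(_ * Y i t) -[RHS]/(a i * Y i t).
  have [->|Yi] := eqVneq (Y i t) 0; first by rewrite !mulr0.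
  by rewrite (Yinj _ _ _ Yi Yj) Qj.
rewrite big1// => i _; rewrite -[LHS]/((if Q i then a i else 0) * Y i t).
case: ifP => Qi; last by rewrite mul0r.
have [->|Yi] := eqVneq (Y i t) 0; first by rewrite mulr0.
by exfalso; apply: nE; exists i.
Qed.

Lemma N_comb_even P (Y : nat -> nat -> R) a m : blocks N P Y ->
  N (comb m (fun i => a i.*2) (fun i => Y i.*2)) <= N (comb m.*2 a Y).
Proof.
move=> hY; apply: le_trans (N_comb_mask (fun i => ~~ odd i) a _ hY).
rewrite comb_double [X in N (_ + X)](_ : _ = 0).
  rewrite addr0 le_eqVlt; apply/orP; left; apply/eqP; congr N.
  by apply: eq_comb => // i; rewrite odd_double.
by rewrite /comb big1// => i _; rewrite /= odd_double scale0r.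
Qed.

Lemma N_comb_odd P (Y : nat -> nat -> R) a m : blocks N P Y ->
  N (comb m (fun i => a i.*2.+1) (fun i => Y i.*2.+1)) <= N (comb m.*2 a Y).
Proof.
move=> hY; apply: le_trans (N_comb_mask odd a _ hY).
rewrite comb_double [X in N (X + _)](_ : _ = 0).
  rewrite add0r le_eqVlt; apply/orP; left; apply/eqP; congr N.
  by apply: eq_comb => // i; rewrite /= odd_double.
by rewrite /comb big1// => i _; rewrite odd_double scale0r.
Qed.

Lemma N_block_gt0 (x : nat -> nat -> R) i : is_block_sequence x -> 0 < N (x i).
Proof.
move=> [cx x0 _]; rewrite lt_neqAle N_ge0// andbT eq_sym; apply/eqP => Nx.
by case: hN => -[h _ _] _; exact: (x0 i (h _ (cx i) Nx)).
Qed.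

Lemma normalized_blocks (x : nat -> nat -> R) : is_block_sequence x ->
  exists P, blocks N P (fun i => (N (x i))^-1 *: x i).
Proof.
move=> hx; have [cx x0 xlt] := hx.
have /choice[P hP] : forall n, exists m, x n m != 0 /\ forall t, x n t != 0 -> (m <= t)%N.
  move=> n; have [[m0 hm0] _ _] := xlt n.
  have exm : exists m, x n m != 0 by exists m0.
  by case: (ex_minnP exm) => m xm hm; exists m.
have Px n t : x n t != 0 -> (P n <= t < P n.+1)%N.
  move=> xt; rewrite (hP n).2//=.
  by have [_ _] := xlt n; apply => //; exact: (hP n.+1).1.
exists P; split => [i|i|i j|i t].
- exact: c00Z.
- have Ni := N_block_gt0 i hx.
  by rewrite (N_homog hN)// gtr0_norm ?invr_gt0// mulVf// gt_eqF.
- move=> /subnK <-; elim: (j - i)%N => [//|d IH]; rewrite addSn.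
  by apply: leq_trans IH _; have /Px/andP[_ /ltnW] := (hP (d + i)%N).1.
by rewrite -[X in X != 0]/(_ * x i t) mulf_eq0 negb_or => /andP[_ /Px].
Qed.

End BlockSequences.

Unset Implicit Arguments.

Theorem mainTheorem3 (R : realType) (N : (nat -> R) -> R)
    (hN : is_schlumprecht_norm N)
    (S : completeNormedModType R) (iota : (nat -> R) -> S)
    (hS : is_completion_c00 N iota)
    (x : nat -> nat -> R) (hx : is_block_sequence x) :
  exists phi : nat -> nat,
    {homo phi : m n / (m < n)%N >-> (m < n)%N} /\
    let Y := closed_span (fun i => iota (x (phi i))) in
    isomorphic_subspaces Y (Y `*` Y).
Proof.
have [iota_lin iota_norm _] := hS; have [cx _ _] := hx.
have [P hb] := normalized_blocks hN hx.
set b := fun i => (N (x i))^-1 *: x i in hb.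
have [psi psi_mono psi_dom] := exists_comparable_subsequence hN hb.
exists psi; split => //=.
have hy := blocks_comp hb psi_mono; have [cy _ _ _] := hy.
have iota0 : iota 0 = 0.
  have := iota_lin 1 0 0 (c000 R) (c000 R); rewrite scale1r addr0 scale1r.
  by move/eqP; rewrite -[X in X == _]addr0 (inj_eq (addrI _)) => /eqP.
have iotaZ a z : c00 z -> iota (a *: z) = a *: iota z.
  by move=> cz; have := iota_lin a z 0 cz (c000 R); rewrite !addr0 iota0 addr0.
pose u i := iota (b (psi i)).
have iota_comb n a (p : nat -> nat) :
    `|comb n a (fun i => u (p i))| = N (comb n a (b \o psi \o p)).
  have cc k : c00 (comb k a (b \o psi \o p)).
    by apply: c00_sum => i _; apply: c00Z; exact: cy.
  rewrite -iota_norm//; congr `|_|; elim: n => [|n IH].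
    by rewrite /comb !big_ord0 iota0.
  move: IH; rewrite /comb !big_ord_recr /= => ->.
  have := iota_lin (a n) (b (psi (p n))) _ (cy (p n)) (cc n).
  by rewrite addrC => <-; rewrite [in RHS]addrC.
(* Normalization only rescales the coefficients by the nonzero numbers [N (x (psi i))]. *)
have -> : closed_span (fun i => iota (x (psi i))) = closed_span u.
  have Nx i : N (x i) != 0 by rewrite gt_eqF// (N_block_gt0 hN).
  apply/seteqP; split => v /closed_spanP h; apply/closed_spanP => e /h[n [a va]].
    exists n, (fun i => a i * N (x (psi i))); move: va; congr (`|v - _| < e).
    by apply: eq_bigr => i _; rewrite /u /b iotaZ// scalerA mulfK.
  exists n, (fun i => a i / N (x (psi i))); move: va; congr (`|v - _| < e).
  by apply: eq_bigr => i _; rewrite /u /b iotaZ// scalerA.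
have id_mono : {homo @id nat : i j / (i < j)%N} by [].
have even_mono : {homo double : i j / (i < j)%N} by move=> i j; rewrite ltn_double.
have odd_mono : {homo (fun i => i.*2.+1) : i j / (i < j)%N}.
  by move=> i j; rewrite ltnS ltn_double.
have id_bound i : (i <= id i <= i.*2.+1)%N by lia.
have even_bound i : (i <= i.*2 <= i.*2.+1)%N by lia.
have odd_bound i : (i <= i.*2.+1 <= i.*2.+1)%N by lia.
(* Equivalence with the even part and with the odd part takes a domination in each direction; the
   odd indices attain the upper bound [i.*2.+1] on the index maps. *)
have [D1 hD1] := psi_dom _ _ id_mono even_mono id_bound even_bound.
have [D2 hD2] := psi_dom _ _ even_mono id_mono even_bound id_bound.
have [D3 hD3] := psi_dom _ _ id_mono odd_mono id_bound odd_bound.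
have [D4 hD4] := psi_dom _ _ odd_mono id_mono odd_bound id_bound.
pose D := `|D1| + `|D2| + `|D3| + `|D4|.
have D0 : 0 <= D by rewrite !addr_ge0.
have leD (t : R) (p q : nat -> nat) m a : t <= D ->
    N (bsum a (b \o psi \o p) 0 m) <= t * N (bsum a (b \o psi \o q) 0 m) ->
    `|comb m a (fun i => u (p i))| <= D * `|comb m a (fun i => u (q i))|.
  move=> tD; rewrite !iota_comb -!bsumE => h; apply: (le_trans h).
  by rewrite !bsumE -iota_comb; exact: ler_wpM2r.
have D1D : D1 <= D by rewrite /D (le_trans (ler_norm D1))// -!addrA lerDl !addr_ge0.
have D2D : D2 <= D.
  by rewrite /D (le_trans (ler_norm D2))// [`|D1| + _]addrC -!addrA lerDl !addr_ge0.
have D3D : D3 <= D.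
  by rewrite /D (le_trans (ler_norm D3))// addrAC lerDr !addr_ge0.
have D4D : D4 <= D by rewrite /D (le_trans (ler_norm D4))// lerDr !addr_ge0.
apply: (isomorphic_square D0).
- by move=> m a; apply: (leD D1 id double) => //; exact: hD1.
- by move=> m a; apply: (leD D2 double id) => //; exact: hD2.
- by move=> m a; apply: (leD D3 id (fun i => i.*2.+1)) => //; exact: hD3.
- by move=> m a; apply: (leD D4 (fun i => i.*2.+1) id) => //; exact: hD4.
- move=> m a; rewrite (iota_comb _ _ double) (iota_comb _ _ id).
  exact: (N_comb_even hN a m hy).
- move=> m a; rewrite (iota_comb _ _ (fun i => i.*2.+1)) (iota_comb _ _ id).
  exact: (N_comb_odd hN a m hy).
Qed.
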